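(* Let $G$ be a transient (connected, oriented, countable) graph of finite positive entropy, $0<h(G)<+\infty$, and let $R=R(G)$. Then there exists a recurrent graph $G'\supset G$ such that $h(G')=h(G)$. Moreover, $G'$ can be chosen to be positive recurrent if $\sum_{n>0} n f_{uu}^G(n)R^n<+\infty$ for some vertex $u$ of $G$, and $G'$ is necessarily null recurrent otherwise (that is, otherwise every recurrent graph $G'\supset G$ with $h(G')=h(G)$ is null recurrent).
   Context: Graphs are oriented, have a countable set of vertices $V(G)$, and have at most one arrow $u\to v$ for each ordered pair of vertices $(u,v)$ (arrows $u\to u$ are allowed). A path of length $n$ is a sequence of vertices $(u_0,\dots,u_n)$ with $u_i\to u_{i+1}$ for $0\le i<n$. A graph is connected if for all vertices $u,v$ there is a path from $u$ to $v$ (strong connectedness). $G'\supset G$ means that $G$ is a subgraph of $G'$. For vertices $u,v$: $p_{uv}^G(n)$ is the number of paths $(u_0,\dots,u_n)$ in $G$ with $u_0=u$, $u_n=v$; $f_{uv}^G(n)$ is the number of such paths which in addition satisfy $u_i\neq v$ for $0<i<n$. For connected $G$, the radius of convergence of $\sum_n p_{uv}^G(n)z^n$ does not depend on $u,v$ and is denoted by $R(G)$ (or $R$). Entropy: $\Gamma_H$ is the set of two-sided infinite paths $(v_n)_{n\in\mathbb{Z}}$ in $H$ and $\sigma$ is the shift. The (Gurevich) entropy is $h(G)=\sup\{h_{top}(\Gamma_H,\sigma) : H\subset G,\ H \text{ a finite subgraph}\}$; for connected $G$ one has $h(G)=-\log R(G)$. Classification: a connected graph $G$ with $R=R(G)$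 is called transient if $\sum_{n>0}f_{uu}^G(n)R^n<1$; null recurrent if $\sum_{n>0}f_{uu}^G(n)R^n=1$ and $\sum_{n>0}nf_{uu}^G(n)R^n=+\infty$; positive recurrent if $\sum_{n>0}f_{uu}^G(n)R^n=1$ and $\sum_{n>0}nf_{uu}^G(n)R^n<+\infty$. These notions do not depend on the vertex $u$. Recurrent means null recurrent or positive recurrent. *)

(* Defs.v *)
From HB Require Import structures.
From mathcomp Require Import all_boot all_order all_algebra.
From mathcomp Require Import all_classical all_reals all_analysis.

Set Implicit Arguments.
Unset Strict Implicit.
Unset Printing Implicit Defensive.

Import Order.TTheory GRing.Theory Num.Theory.

Local Open Scope classical_set_scope.
Local Open Scope ereal_scope.

Record graph : Type := Graph {
  vertex :> countType;
  arrow : rel vertex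
}.

(* H is a subgraph of G up to renaming of the vertices: distinct graphs have
   distinct vertex types, so the inclusion is an injective map that preserves
   arrows. The subgraph need not be induced. *)
Definition subgraph (H G : graph) : Prop :=
  exists i : H -> G,
    injective i /\ forall u v : H, arrow u v -> arrow (i u) (i v).

Definition finite_graph (G : graph) : Prop := finite_set [set: G].

Section paths.
Variable G : graph.
Implicit Types (u v : G) (n : nat) (s : seq G).

(* A path (u_0, ..., u_n) is represented by its origin u_0 and the sequence
   s = [:: u_1; ...; u_n]. *)
Definition paths u v n : set (seq G) :=
  [set s | [/\ size s = n, path (@arrow G) u s & last u s = v]].

Definition first_paths u v n : set (seq G) :=
  [set s | paths u v n s /\
           forall i, (0 < i < n)%N -> nth u (u :: s) i != v].

Definition connected_graph : Prop := forall u v, exists n, paths u v n !=set0.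

End paths.

Section topological_entropy.
Variables (R : realType) (T : topologicalType) (f : T -> T) (K : set T).

Definition open_cover (U : set (set T)) : Prop :=
  (forall A, U A -> open A) /\ K `<=` \bigcup_(A in U) A.

(* U \/ f^-1 U \/ ... \/ f^-(n-1) U *)
Definition iter_join (U : set (set T)) (n : nat) : set (set T) :=
  [set \bigcap_(i in `I_n) (iter i f @^-1` a i) |
     a in [set a : nat -> set T | forall i, (i < n)%N -> U (a i)]].

Definition min_subcover (U : set (set T)) : \bar R :=
  ereal_inf [set counting W |
    W in [set W : set (set T) | W `<=` U /\ K `<=` \bigcup_(A in W) A]].

(* By subadditivity the upper limit is a limit when f is continuous and K is
   compact and stable under f. *)
Definition cover_entropy (U : set (set T)) : \bar R :=
  limn_esup (fun n => (n%:R^-1)%:E * lne (min_subcover (iter_join U n))).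

(* Entropy of the restriction of f to K (Adler-Konheim-McAndrew); relatively
   open covers of K are replaced by covers of K by open sets of T. *)
Definition topological_entropy : \bar R :=
  ereal_sup [set cover_entropy U | U in open_cover].

End topological_entropy.

Section two_sided_paths.
Variable G : graph.

Definition bisequence : topologicalType :=
  prod_topology (fun _ : int => discrete_topology G).

Definition shift (x : bisequence) : bisequence := fun i => x (i + 1)%R.

Definition two_sided_paths : set bisequence :=
  [set x | forall i : int, arrow (x i : G) (x (i + 1)%R : G)].

End two_sided_paths.

Section invariants.
Variables (R : realType) (G : graph).
Implicit Types (u v : G) (n : nat).

Definition entropy : \bar R :=
  ereal_sup [set h | exists H : graph,
    [/\ finite_graph H, subgraph H G &
        h = topological_entropy R (@shift H) (@two_sided_paths H)]].

Definition p_ u v n : \bar R := counting (paths u v n).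

Definition f_ u v n : \bar R := counting (first_paths u v n).

(* The coefficients are nonnegative, so convergence at r is finiteness of the
   sum and implies convergence on the closed disk of radius r. *)
Definition conv_radius (a : nat -> \bar R) : \bar R :=
  ereal_sup [set r%:E | r in
    [set r : R | (0 <= r)%R /\ \sum_(0 <= n <oo) a n * (r ^+ n)%:E < +oo]].

(* When G is connected the radii for all u, v coincide; the infimum merely
   names their common value. *)
Definition graph_radius : \bar R :=
  ereal_inf [set conv_radius (p_ uv.1 uv.2) | uv in [set: G * G]].

Definition return_sum u : \bar R :=
  \sum_(1 <= n <oo) f_ u u n * graph_radius ^+ n.

Definition return_mean u : \bar R :=
  \sum_(1 <= n <oo) n%:R%:E * f_ u u n * graph_radius ^+ n.

Definition transient : Prop :=
  connected_graph G /\ forall u, return_sum u < 1.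

Definition null_recurrent : Prop :=
  connected_graph G /\ forall u, return_sum u = 1 /\ return_mean u = +oo.

Definition positive_recurrent : Prop :=
  connected_graph G /\ forall u, return_sum u = 1 /\ return_mean u < +oo.

Definition recurrent : Prop := null_recurrent \/ positive_recurrent.

End invariants.

(* Main.v *)
(* Fix a vertex u of G and let R = R(G) < 1. Attach to u, for each n, c_n new
   loops of length n, where 1 - sum f_uu(n) R^n = sum c_n R^n is a greedy
   expansion in base 1/R; these loops only add c_n to f_uu(n). In the extension
   G' the first-return series at u equals 1 at R, so it is < 1 on [0, R) and
   R(G') = R. As the digits c_n R^n decay geometrically, the mean return time
   stays finite if it was finite in G.

   That recurrence and the finiteness of the mean return time do not depend on
   the vertex follows from the renewal equation P = 1 + F P: the values P_u(s R)
   and P_v(s R) are comparable for s < 1, and (1 - F_u(s R)) / (1 - s) tends to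
   the mean return time as s -> 1.

   Entropies are compared through h = - log R. For "<=", an open cover is refined
   by cylinders, and words of a finite subgraph are counted by paths of G; for
   ">=", many loops of equal length at one vertex span a finite subgraph in which
   they can be concatenated freely. *)
From mathcomp Require Import all_boot all_order all_algebra finmap.
From mathcomp Require Import all_classical all_reals all_analysis.
From mathcomp Require Import ring lra zify.
Require Import Defs.

Set Implicit Arguments.
Unset Strict Implicit.
Unset Printing Implicit Defensive.

Import Order.TTheory GRing.Theory Num.Theory.
Import numFieldNormedType.Exports.

Local Open Scope classical_set_scope.
Local Open Scope ring_scope.

(** * Renewal sequences *)

Section Renewal.
Variable R : realType.
Implicit Types (a b w : nat -> R) (x q S s m c : R).

(** Convergence is handled by bounding partial sums: a nonnegative series has sum [x] when [x] is
    the least such bound. *)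
Definition sums_le w x := forall N, \sum_(k < N) w k <= x.

(** In generating functions, [B = 1 / (1 - A)]. The index of [a] is shifted: [a k] stands for
    returns of length [k.+1]. *)
Definition renewal a b :=
  b 0 = 1 /\ forall n, b n.+1 = \sum_(k < n.+1) a k * b (n - k)%N.

Lemma ler_sum_ord w (N M : nat) : (forall n, 0 <= w n) -> (N <= M)%N ->
  \sum_(k < N) w k <= \sum_(k < M) w k.
Proof.
move=> w0 /subnK <-; elim: (M - N)%N => //= n ih.
by rewrite addSn big_ord_recr /=; apply: (le_trans ih); rewrite lerDl.
Qed.

(* The identity [B = 1 + A B] of generating functions, before any limit. *)
Lemma renewal_partial_sum a b (N : nat) : renewal a b ->
  \sum_(n < N.+1) b n = 1 + \sum_(k < N) a k * \sum_(n < N - k) b n.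
Proof.
move=> [b0 bS]; elim: N => [|N ih].
  by rewrite big_ord_recr !big_ord0 /= b0 addr0 add0r.
rewrite big_ord_recr /= ih bS -addrA; congr (1 + _).
rewrite [in RHS]big_ord_recr [in LHS]big_ord_recr /=.
rewrite subnn subSnn addrA -big_split /=; congr (_ + _).
  by apply: eq_bigr => k _; rewrite -mulrDr subSn 1?ltnW// big_ord_recr.
by rewrite big_ord_recr big_ord0 /= add0r.
Qed.

Lemma renewal_ge0 a b : (forall n, 0 <= a n) -> renewal a b ->
  forall n, 0 <= b n.
Proof.
move=> a0 [b0 bS] n; have [N] := ubnP n; elim: N n => // N ih [|n] nN.
  by rewrite b0.
by rewrite bS sumr_ge0// => k _; rewrite mulr_ge0// ih//; lia.
Qed.

(** In [renewal_partial_sum] every inner sum is at most the full partial sum B, so B <= 1 + q B,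
    which can be solved for the finite number B. *)
Lemma renewal_sum_le a b q : (forall n, 0 <= a n) -> renewal a b ->
  sums_le a q -> q < 1 -> sums_le b (1 - q)^-1.
Proof.
move=> a0 ab aq q1 N; have b0 := renewal_ge0 a0 ab.
apply: le_trans (ler_sum_ord b0 (leqnSn N)) _.
rewrite -[leRHS]mul1r ler_pdivlMr ?subr_gt0// mulrBr mulr1.
rewrite lerBlDr {1}(renewal_partial_sum _ ab) lerD2l.
rewrite mulrC (le_trans (y := (\sum_(k < N) a k) * \sum_(n < N.+1) b n))//.
  rewrite mulr_suml; apply: ler_sum => k _; apply: ler_wpM2l => //.
  by apply: ler_sum_ord => //; lia.
by apply: ler_wpM2r; rewrite ?sumr_ge0.
Qed.

(** With B the sum of the series [b], each partial sum A of [a] satisfies 1 + A B <= B, hence A <= 1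
    - 1/B <= 1 - 1/S. The limit B is needed because the inequality between partial sums relates two
    different lengths. *)
Lemma renewal_return_le a b S : (forall n, 0 <= a n) -> renewal a b ->
  sums_le b S -> sums_le a (1 - S^-1).
Proof.
move=> a0 ab bS N; have b0 := renewal_ge0 a0 ab.
have S1 : 1 <= S.
  by have := bS 1; rewrite big_ord_recr big_ord0 /= (ab.1) add0r.
set A := \sum_(k < N) a k.
have A0 : 0 <= A by apply: sumr_ge0.
(* For [k < N] the inner sum runs over at least [M] terms; the indices [k >= N] are dropped. *)
have AB M : 1 + A * \sum_(n < M) b n <= \sum_(n < (N + M).+1) b n.
  rewrite (renewal_partial_sum _ ab) lerD2l.
  rewrite big_split_ord /= -[leLHS]addr0; apply: lerD; last first.
    by apply: sumr_ge0 => k _; rewrite mulr_ge0// sumr_ge0.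
  rewrite mulr_suml; apply: ler_sum => k _; apply: ler_wpM2l => //.
  by apply: ler_sum_ord => //; have := ltn_ord k; lia.
have cB : cvgn (series b).
  apply: nondecreasing_is_cvgn; last first.
    by exists S => _ [n _ <-]; rewrite /series /= big_mkord.
  by apply/nondecreasing_seqP => n; rewrite /series /= big_nat_recr //= lerDl.
set B := limn (series b).
have B1 : 1 <= B.
  apply: limr_ge => //; exists 1%N => // n /= n1; rewrite /series /= big_mkord.
  by case: n n1 => // n _; rewrite big_ord_recl ab.1 lerDl sumr_ge0.
have BS : B <= S.
  by apply: limr_le => //; apply: nearW => n; rewrite /series /= big_mkord.
have AB' : 1 + A * B <= B.
  have cAB : (fun n => 1 + A * series b n) @ \oo --> 1 + A * B.
    by apply: cvgD; [exact: cvg_cst | apply: cvgMl_tmp].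
  rewrite -(cvg_lim _ cAB)//; apply: limr_le.
    by apply/cvg_ex; eexists; exact: cAB.
  apply: nearW => n.
  apply: limr_ge => //; exists (N + n).+1 => // m /= nm.
  by rewrite /series /= !big_mkord (le_trans (AB n))// ler_sum_ord.
rewrite -(ler_pM2r (x := B)) ?(lt_le_trans ltr01)//.
apply: (@le_trans _ _ (B - 1)); first by rewrite lerBrDl.
rewrite mulrBl mul1r lerD2l lerN2 mulrC ler_pdivrMr ?mul1r// (lt_le_trans ltr01)//.
Qed.

Lemma renewal_scale a b s : renewal a b ->
  renewal (fun k => a k * s ^+ k.+1) (fun n => b n * s ^+ n).
Proof.
move=> [b0 bS]; split=> [|n]; first by rewrite b0 mulr1.
rewrite bS mulr_suml; apply: eq_bigr => k _.
by rewrite mulrACA -exprD addSn subnKC// -ltnS.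
Qed.

Lemma le_of_mul_expr_le x y K :
  (forall s, 0 < s < 1 -> x * s ^+ K <= y) -> x <= y.
Proof.
move=> xy; have cx : (fun s => x * s ^+ K) @ (1:R)^'- --> x * 1 ^+ K.
  by apply: cvg_at_left_filter; apply: cvgMl_tmp; apply: exprn_continuous.
rewrite -[x]mulr1 -(expr1n _ K) -(cvg_lim _ cx)//; apply: limr_le.
  by apply/cvg_ex; eexists; exact: cx.
near=> s; apply: xy; apply/andP; split; near: s.
  exact: nbhs_left_gt.
exact: nbhs_left_lt.
Unshelve. all: by end_near. Qed.

(** For [s < 1] the return series at [s] is at most 1 by [renewal_return_le]; its first [N] terms
    lose at most a factor [s ^+ N], and [s] tends to 1. *)
Lemma renewal_return_le1 a b : (forall n, 0 <= a n) -> renewal a b ->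
  (forall s, 0 < s < 1 -> exists S, sums_le (fun n => b n * s ^+ n) S) ->
  sums_le a 1.
Proof.
move=> a0 ab bs N; apply: (@le_of_mul_expr_le _ _ N) => s /andP[s0 s1].
have as0 n : 0 <= a n * s ^+ n.+1 by rewrite mulr_ge0// exprn_ge0// ltW.
have [|S bS] := bs s; first by rewrite s0.
have S1 : 1 <= S.
  by have := bS 1; rewrite big_ord_recr big_ord0 /= (ab.1) add0r mul1r.
have aS := renewal_return_le as0 (renewal_scale s ab) bS N.
apply: le_trans (le_trans aS _); last first.
  by rewrite lerBlDr lerDl invr_ge0 (le_trans ler01).
rewrite mulr_suml; apply: ler_sum => k _; apply: ler_wpM2l => //.
by apply: ler_wiXn2l; rewrite ?ltW.
Qed.

Lemma onem_expr s n : 1 - s ^+ n = (1 - s) * \sum_(i < n) s ^+ i.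
Proof. by rewrite -opprB subrX1 -mulNr opprB. Qed.

Lemma onem_expr_le s n : 0 <= s <= 1 -> 1 - s ^+ n <= n%:R * (1 - s).
Proof.
move=> /andP[s0 s1]; rewrite onem_expr mulrC ler_wpM2r ?subr_ge0//.
rewrite -[n in leRHS]card_ord -sumr_const.
by apply: ler_sum => i _; rewrite exprn_ile1.
Qed.

Lemma mul_expr_le_onem s n : 0 <= s <= 1 ->
  n.+1%:R * (s ^+ n * (1 - s)) <= 1 - s ^+ n.+1.
Proof.
move=> /andP[s0 s1]; rewrite onem_expr mulrA mulrC ler_wpM2l ?subr_ge0//.
rewrite mulr_natl -[n.+1 in leLHS]card_ord -sumr_const.
by apply: ler_sum => i _; rewrite ler_wiXn2l// -ltnS.
Qed.

(** * Transfer of recurrence and of a finite mean between renewal sequences *)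

Section Transfer.
Variables (a b a' b' : nat -> R) (c : R) (d : nat).
Hypotheses (a_ge0 : forall n, 0 <= a n) (a'_ge0 : forall n, 0 <= a' n).
Hypotheses (ab : renewal a b) (ab' : renewal a' b') (c_gt0 : 0 < c).
Hypothesis bb' : forall n, c * b n <= b' (n + d)%N.
Hypothesis a_ge1 : forall x, sums_le a x -> 1 <= x.

Let sums_le_scale s S : 0 < s -> sums_le (fun n => b' n * s ^+ n) S ->
  sums_le (fun n => b n * s ^+ n) (S / (c * s ^+ d)).
Proof.
move=> s0 bS N; have b'0 := renewal_ge0 a'_ge0 ab'.
rewrite ler_pdivlMr ?mulr_gt0 ?exprn_gt0//.
apply: le_trans (bS (d + N)%N); rewrite big_split_ord /= -[leLHS]add0r.
apply: lerD.
  by apply: sumr_ge0 => k _; rewrite mulr_ge0// exprn_ge0// ltW.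
rewrite mulr_suml; apply: ler_sum => k _.
rewrite mulrACA [b _ * c]mulrC -exprD [(k + d)%N]addnC ler_wpM2r//.
  by rewrite exprn_ge0// ltW.
by rewrite [(d + k)%N]addnC.
Qed.

(** A bound below 1 on the sums of [a'] would bound those of [b'], hence those of [b], and force the
    sum of [a] strictly below 1. *)
Lemma renewal_recurrent_transfer x : sums_le a' x -> 1 <= x.
Proof.
move=> a'x; rewrite leNgt; apply/negP => x1.
have bS : sums_le b ((1 - x)^-1 / c).
  have scale1 (u : nat -> R) : u = fun n => u n * 1 ^+ n.
    by apply/funext => n; rewrite expr1n mulr1.
  have := @sums_le_scale 1 (1 - x)^-1 ltr01; rewrite -!scale1 expr1n mulr1.
  by apply; exact: renewal_sum_le a'x x1.
have /a_ge1 := renewal_return_le a_ge0 ab bS.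
by rewrite leNgt ltrBlDr ltrDl invr_gt0 divr_gt0// invr_gt0 subr_gt0.
Qed.

Lemma renewal_mean_transfer m : sums_le (fun k => k.+1%:R * a k) m ->
  sums_le a' 1 -> sums_le (fun k => k.+1%:R * a' k) (m / c).
Proof.
(* The exponent collects [s ^+ d] from the shift and [s ^+ N] from the truncated mean. *)
move=> am a'1 N; apply: (@le_of_mul_expr_le _ _ (d + N)) => s /andP[s0 s1].
have s01 : 0 <= s <= 1 by rewrite !ltW.
have s1_ge0 : 0 <= 1 - s by rewrite subr_ge0 ltW.
have m0 : 0 <= m by have := am 0; rewrite big_ord0.
have as0 n : 0 <= a n * s ^+ n.+1 by rewrite mulr_ge0// exprn_ge0// ltW.
have as0' n : 0 <= a' n * s ^+ n.+1 by rewrite mulr_ge0// exprn_ge0// ltW.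
(* [e] bounds from below [1 - A'(s)], the inverse of [B'(s)]; it is at least
   [1 - s] times a truncated mean (up to [s ^+ N]) and at most
   [m * (1 - s) / (c * s ^+ d)], because [B'(s)] dominates [B(s)]. *)
pose e := \sum_(k < N) a' k * (1 - s ^+ k.+1).
have xe : (\sum_(k < N) k.+1%:R * a' k) * s ^+ N * (1 - s) <= e.
  rewrite !mulr_suml; apply: ler_sum => k _.
  rewrite -!mulrA mulrCA ler_wpM2l//.
  apply: le_trans (mul_expr_le_onem _ s01).
  rewrite ler_wpM2l// ler_wpM2r//.
  by rewrite ler_wiXn2l ?(ltW s0) ?(ltW s1) ?(ltnW (ltn_ord k)).
have e0 : 0 <= e.
  apply: sumr_ge0 => k _; rewrite mulr_ge0// subr_ge0 exprn_ile1// ltW//.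
(* Passing to [N + M] terms includes all the indices counted in [e]; on these the scaling by powers
   of [s] loses exactly [e] from a total of at most 1. *)
have ae : sums_le (fun k => a' k * s ^+ k.+1) (1 - e).
  move=> M; apply: le_trans (ler_sum_ord as0' (leq_addl N M)) _.
  rewrite lerBrDr (le_trans _ (a'1 (N + M)%N))// !big_split_ord /=.
  rewrite addrAC -big_split /=; apply: lerD.
    by apply: ler_sum => k _; rewrite -mulrDr addrC subrK mulr1.
  by apply: ler_sum => k _; rewrite ler_piMr// exprn_ile1// ltW.
have em : e * (c * s ^+ d) <= m * (1 - s).
  (* [renewal_sum_le] requires a bound strictly below 1, so [e = 0] is treated apart. *)
  have [e_gt0|] := ltP 0 e; last first.
    move=> ele0; have -> : e = 0 by apply/eqP; rewrite eq_le ele0.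
    by rewrite mul0r mulr_ge0// subr_ge0 ltW.
  have bS := renewal_sum_le as0' (renewal_scale s ab') ae.
  rewrite opprB addrCA subrr addr0 in bS.
  have {}bS := sums_le_scale s0 (bS _).
  rewrite ltrBlDr ltrDl in bS; have {}bS := bS e_gt0.
  have aS := renewal_return_le as0 (renewal_scale s ab) bS.
  rewrite invfM !invrK in aS.
  (* By [a_ge1] the sum of [a] is at least 1, and it exceeds its value at [s] by at most
     [m * (1 - s)]. *)
  have : 1 <= 1 - e * (c * s ^+ d) + m * (1 - s).
    apply: a_ge1 => M; apply: (@le_trans _ _ (\sum_(k < M) (a k * s ^+ k.+1) +
      \sum_(k < M) (k.+1%:R * a k) * (1 - s))); last first.
      by rewrite -mulr_suml lerD// ler_wpM2r// subr_ge0 ltW.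
    rewrite -big_split; apply: ler_sum => k _ /=.
    rewrite [_%:R * _]mulrC -mulrA -mulrDr ler_peMr// -lerBlDl.
    exact: onem_expr_le.
  by rewrite -addrA lerDl addrC subr_ge0.
rewrite ler_pdivlMr// -(ler_pM2r (x := 1 - s)) ?subr_gt0//.
apply: le_trans em; rewrite exprD; apply: le_trans (ler_wpM2r _ xe); last first.
  by rewrite mulr_ge0 ?exprn_ge0// ltW.
by rewrite le_eqVlt; apply/orP; left; apply/eqP; ring.
Qed.
End Transfer.

(** The truncated derivative of the geometric series has a closed form: times [(1 - s) ^+ 2] it is 1
    minus a nonnegative term. *)
Lemma sum_mul_expr_le s : 0 <= s < 1 ->
  sums_le (fun k => k.+1%:R * s ^+ k) ((1 - s) ^- 2).
Proof.
move=> /andP[s0 s1] N; rewrite -[leRHS]mul1r ler_pdivlMr ?exprn_gt0 ?subr_gt0//.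
have -> : (\sum_(k < N) k.+1%:R * s ^+ k) * (1 - s) ^+ 2 =
    1 - s ^+ N * (1 + N%:R * (1 - s)).
  elim: N => [|N ih]; first by rewrite big_ord0 expr0; ring.
  by rewrite big_ord_recr /= mulrDl ih [s ^+ N.+1]exprS -natr1; ring.
rewrite gerBl mulr_ge0 ?exprn_ge0// addr_ge0// mulr_ge0// subr_ge0 ltW//.
Qed.

(* The digits are chosen greedily: each remainder is less than the last power of
   [r] used, hence the geometric decay behind the last clause. Expansions start
   at [r^2] because a graph has no room for several loops of length 1. *)
Lemma digit_expansion x (r : R) : 0 <= x -> 0 < r < 1 ->
  exists c : nat -> nat,
  [/\ sums_le (fun k => (c k)%:R * r ^+ k.+2) x,
      forall y, sums_le (fun k => (c k)%:R * r ^+ k.+2) y -> x <= y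
    & exists m, sums_le (fun k => k.+2%:R * ((c k)%:R * r ^+ k.+2)) m].
Proof.
move=> x0 /andP[r0 r1].
(* [e n] is the remainder before digit [n], and [c n] is the largest integer with
   [c n * r ^+ n.+2 <= e n]. *)
pose next n e := e - (Num.truncn (e / r ^+ n.+2))%:R * r ^+ n.+2.
pose e := fix e n := if n is n'.+1 then next n' (e n') else x.
pose c n := Num.truncn (e n / r ^+ n.+2).
have eS n : e n.+1 = e n - (c n)%:R * r ^+ n.+2 by [].
have rn n : 0 < r ^+ n by rewrite exprn_gt0.
have e_ge0 n : 0 <= e n.
  elim: n => // n ih; rewrite eS subr_ge0 -ler_pdivlMr// /c.
  by rewrite truncn_le divr_ge0// ltW.
have e_lt n : e n.+1 < r ^+ n.+2.
  rewrite eS ltrBlDl -[X in _ < _ + X]mul1r -mulrDl -ltr_pdivrMr// natr1.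
  by have /andP[] := truncn_itv (divr_ge0 (e_ge0 n) (ltW (rn n.+2))).
have sumE N : \sum_(k < N) (c k)%:R * r ^+ k.+2 = x - e N.
  elim: N => [|N ih]; first by rewrite big_ord0 subrr.
  by rewrite eS big_ord_recr /= ih; ring.
exists c; split.
- by move=> N; rewrite sumE gerBl.
- move=> y cy; rewrite leNgt; apply/negP => yx.
  have [N rN] : exists N, r ^+ N < x - y.
    have cr : GRing.exp r @ \oo --> (0 : R) by apply: cvg_expr; rewrite gtr0_norm.
    have xy : 0 < x - y by rewrite subr_gt0.
    have [N _ /(_ N (leqnn N))] := cvgr_lt _ cr _ xy.
    by exists N.
  have := cy N.+1; rewrite sumE lerBlDr -lerBlDl leNgt.
  rewrite (lt_trans (e_lt N))// (le_lt_trans _ rN)//.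
  by rewrite ler_wiXn2l ?(ltW r0) ?(ltW r1)// -addn2 leq_addr.
- have e_le n : e n <= (x + 1) * r ^+ n.
    case: n => [|n]; first by rewrite mulr1 lerDl.
    apply: ltW; apply: lt_le_trans (e_lt n) _.
    rewrite exprS ler_wpM2r ?(ltW (rn _))// (le_trans (ltW r1))// lerDr//.
  (* Each digit term is at most the remainder [e k <= (x + 1) * r ^+ k], and [k.+2 <= 2 * k.+1];
     [sum_mul_expr_le] bounds the rest. *)
  exists ((x + 1) * 2 * (1 - r) ^- 2) => N.
  have : 0 <= r < 1 by rewrite ltW.
  move=> /sum_mul_expr_le/(_ N); move/(ler_wpM2l (x := (x + 1) * 2)).
  have x2 : 0 <= (x + 1) * 2 by rewrite mulr_ge0// addr_ge0.
  move=> /(_ x2); apply: le_trans; rewrite mulr_sumr; apply: ler_sum => k _.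
  have ck : (c k)%:R * r ^+ k.+2 <= (x + 1) * r ^+ k.
    by apply: le_trans (e_le k); rewrite -subr_ge0 -eS.
  rewrite [leRHS](_ : _ = k.+1%:R * 2 * ((x + 1) * r ^+ k)); last by ring.
  apply: ler_pM => //; first by rewrite mulr_ge0// ltW.
  by rewrite -natrM ler_nat; lia.
Qed.

End Renewal.

Local Open Scope ereal_scope.

(** * Counting paths *)

Section Counting.
Context {R : realType}.

Lemma counting_finite (T : choiceType) (A : set T) : finite_set A ->
  counting A = (#|` fset_set A|%:R)%:E :> \bar R.
Proof. by move=> fA; rewrite /counting asboolT. Qed.

Lemma counting_infinite (T : choiceType) (A : set T) : infinite_set A ->
  counting A = +oo :> \bar R.
Proof. by move=> fA; rewrite /counting asboolF. Qed.

Lemma counting_ge0 (T : choiceType) (A : set T) : 0 <= counting A :> \bar R.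
Proof. by rewrite /counting; case: ifPn; rewrite ?lee_fin ?leey. Qed.

Lemma counting_set0 (T : choiceType) : counting (set0 : set T) = 0 :> \bar R.
Proof. by rewrite counting_finite// fset_set0. Qed.

(** As a sum of ones, a cardinality can be reindexed along a bijection and split over fibres,
    whether finite or not. *)
Lemma counting_esum (T : choiceType) (A : set T) :
  counting A = \esum_(x in A) 1 :> \bar R.
Proof.
have [fA|iA] := pselect (finite_set A).
  rewrite counting_finite// esum_fset// fsbig_finite//=.
  by rewrite sumEFin big_const_seq count_predT iter_addr addr0.
rewrite counting_infinite//; apply/esym/eqyP => r r0.
have [n rn] : exists n : nat, (r <= n%:R)%R.
  by exists (Num.truncn r).+1; have /andP[_ /ltW] := truncn_itv (ltW r0).
have [X XA nX] := infinite_set_fset n iA.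
apply: esum_ge; exists [set` X]; first by split.
rewrite fsbig_finite//= set_fsetK sumEFin big_const_seq count_predT iter_addr addr0.
by rewrite lee_fin (le_trans rn)// ler_nat.
Qed.

Lemma counting_image (T U : choiceType) (f : T -> U) (A : set T) :
  set_inj A f -> counting (f @` A) = counting A :> \bar R.
Proof. by move=> fA; rewrite !counting_esum esum_image. Qed.

Lemma le_counting (T : choiceType) (A B : set T) :
  A `<=` B -> counting A <= counting B :> \bar R.
Proof.
move=> AB; rewrite !counting_esum; apply: ereal_sup_le => _ [X [fX XA] <-].
by exists X => //; split => // x /XA /AB.
Qed.

Lemma le_counting_inj (T U : choiceType) (f : T -> U) (A : set T) (B : set U) :
  set_inj A f -> (forall x, A x -> B (f x)) -> counting A <= counting B :> \bar R.
Proof.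
by move=> /counting_image <- fAB; apply: le_counting => _ [x Ax <-]; exact: fAB.
Qed.

Lemma counting_ge1 (T : choiceType) (A : set T) : A !=set0 ->
  1 <= counting A :> \bar R.
Proof.
move=> [x Ax]; have : counting [set x] <= counting A :> \bar R.
  by apply: le_counting => _ ->.
by rewrite counting_finite// fset_set1 cardfs1.
Qed.

Lemma counting_ord n : counting [set: 'I_n] = n%:R%:E :> \bar R.
Proof.
rewrite -(counting_image (f := @nat_of_ord n)) => [|i j _ _]; last exact: val_inj.
rewrite (_ : _ @` _ = `I_n); last first.
  by apply/seteqP; split=> [_ [i _ <-]|i ni] //=; exists (Ordinal ni).
by rewrite counting_finite// (card_fset_set (card_eqxx _)).
Qed.

Lemma countingX (T U : choiceType) (A : set T) (B : set U) :
  counting (A `*` B) = counting A * counting B :> \bar R.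
Proof.
(* Empty factors come first because [0 * +oo = 0]; when both sets are nonempty, one infinite factor
   makes the product infinite. *)
have [->|/set0P[x Ax]] := eqVneq A set0.
  by rewrite set0X !counting_set0 mul0e.
have [->|/set0P[y By]] := eqVneq B set0.
  by rewrite setX0 !counting_set0 mule0.
have [fA|iA] := pselect (finite_set A); last first.
  rewrite (counting_infinite iA) counting_infinite ?gt0_mulye//.
    by apply: lt_le_trans lte01 _; apply: counting_ge1; exists y.
  apply: contra_not iA => /(finite_image fst); apply: sub_finite_set.
  by move=> z Az; exists (z, y).
have [fB|iB] := pselect (finite_set B); last first.
  rewrite (counting_infinite iB) counting_infinite ?gt0_muley//.
    by apply: lt_le_trans lte01 _; apply: counting_ge1; exists x.
  apply: contra_not iB => /(finite_image snd); apply: sub_finite_set.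
  by move=> z Bz; exists (x, z).
transitivity (\esum_(i in A) \esum_(j in B) (1 : \bar R)).
  by rewrite esum_esum// counting_esum.
under eq_esum do rewrite -counting_esum (counting_finite fB).
rewrite esum_fset// fsbig_finite//= !counting_finite// sumEFin.
by rewrite big_const_seq count_predT iter_addr addr0 -EFinM mulr_natl.
Qed.

Lemma countingU (T : choiceType) (A B : set T) : [disjoint A & B] ->
  counting (A `|` B) = counting A + counting B :> \bar R.
Proof.
move=> /disj_set2P AB.
have [fA|iA] := pselect (finite_set A); last first.
  rewrite (counting_infinite iA) addye -?ltNye ?(lt_le_trans _ (counting_ge0 _))//.
  apply: counting_infinite; apply: contra_not iA; apply: sub_finite_set => x.
  by left.
have [fB|iB] := pselect (finite_set B); last first.
  rewrite (counting_infinite iB) addey -?ltNye ?(lt_le_trans _ (counting_ge0 _))//.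
  apply: counting_infinite; apply: contra_not iB; apply: sub_finite_set => x.
  by right.
rewrite !counting_finite ?finite_setU// fset_setU// cardfsU.
by rewrite -fset_setI// AB fset_set0 cardfs0 subn0 natrD.
Qed.

End Counting.

Section Paths.
Variables (R : realType) (G : graph).
Implicit Types (u v w : G) (s : seq G).

Lemma paths_cat u v w m n s t :
  paths u v m s -> paths v w n t -> paths u w (m + n) (s ++ t).
Proof.
by move=> [<- us <-] [<- vt <-]; split; rewrite ?size_cat ?last_cat ?cat_path ?us.
Qed.

Lemma first_paths_sub u v n : first_paths u v n `<=` paths u v n.
Proof. by move=> s []. Qed.

Lemma first_pathsP u v n s : first_paths u v n.+1 s <->
  exists s', [/\ s = rcons s' v, size s' = n, path (@arrow G) u s & v \notin s'].
Proof.
split=> [[[ss us <-] fs]|[s' [-> ss us vs]]].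
  case/lastP: s => // s x in ss us fs *; rewrite last_rcons in fs *.
  move: ss; rewrite size_rcons => -[ss]; exists s; split=> //.
  apply/negP => xs; have := fs (index x s).+1.
  by rewrite /= nth_rcons -ss ltnS index_mem xs nth_index// eqxx => /(_ isT).
split; first by split; rewrite ?size_rcons ?ss ?last_rcons.
move=> [//|k] /=; rewrite ltnS => kn; rewrite nth_rcons ss kn.
by apply: contraNneq vs => <-; rewrite mem_nth ?ss.
Qed.

Lemma f_le_p u v n : f_ R u v n <= p_ R u v n.
Proof. exact: le_counting (@first_paths_sub _ _ _). Qed.

Lemma le_p_cat u v u' v' m k n s t : paths u' u m s -> paths v v' n t ->
  p_ R u v k <= p_ R u' v' (m + (k + n)).
Proof.
move=> us vt; apply: (le_counting_inj (f := fun r => s ++ (r ++ t))).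
  move=> r r' /set_mem[sr _ _] /set_mem[sr' _ _] /eqP.
  by rewrite eqseq_cat// eqxx /= eqseq_cat ?sr ?sr'// => /andP[/eqP].
by move=> r uvr; apply: paths_cat us _; exact: paths_cat vt.
Qed.

Lemma p_0 u : p_ R u u 0 = 1.
Proof.
rewrite /p_ (_ : paths u u 0 = [set [::]]); last first.
  by apply/seteqP; split=> s => [[/size0nil]|->].
by rewrite counting_finite// fset_set1 cardfs1.
Qed.

(** Otherwise the arrival of [s] at [u], at time [m.+1], would fall strictly inside [s']. *)
Lemma first_paths_le_cat u m n m' n' s s' t t' :
  first_paths u u m.+1 s -> paths u u n t ->
  first_paths u u m'.+1 s' -> paths u u n' t' ->
  s ++ t = s' ++ t' -> (m' <= m)%N.
Proof.
move=> [[ss _ ls] _] _ [[ss' _ _] fs'] _ st; rewrite leqNgt; apply/negP => mm'.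
have /negP := fs' m.+1 mm'; apply; rewrite -[X in _ == X]ls -nth_last ss /=.
have := congr1 (fun r => nth u r m) st.
by rewrite !nth_cat ss ss' ltnSn (leqW mm') => ->.
Qed.

(** A closed path of positive length is cut at its first return to [u], which happens at time
    [k.+1]. *)
Lemma first_return_bij u n : set_bij
  (`I_n.+1 `*`` fun k => first_paths u u k.+1 `*` paths u u (n - k))
  (paths u u n.+1) (fun x => x.2.1 ++ x.2.2).
Proof.
split.
- move=> [k [s t]] /= [kn [/first_paths_sub us ut]].
  by have := paths_cat us ut; rewrite addSn subnKC.
- move=> [k [s t]] [k' [s' t']] /set_mem/= [_ [us ut]] /set_mem/= [_ [us' ut']] st.
  have kk' : k = k'.
    apply/eqP; rewrite eqn_leq (first_paths_le_cat us' ut' us ut)//.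
    by rewrite (first_paths_le_cat us ut us' ut').
  rewrite -{}kk' in us' *.
  move/eqP: st; rewrite eqseq_cat; first by move=> /andP[/eqP-> /eqP->].
  by case: us us' => -[-> _ _ _] [[->]].
- move=> s [ss us ls].
  have uins : u \in s by rewrite -ls; case: s ss {us ls} => //= x s _; rewrite mem_last.
  pose k := index u s; have ks : (k < size s)%N by rewrite index_mem.
  have sk : size (take k.+1 s) = k.+1 by rewrite size_takel.
  have lk : last u (take k.+1 s) = u.
    by rewrite (last_nth u) sk /= nth_take// nth_index.
  have := us; rewrite -{1}(cat_take_drop k.+1 s) cat_path lk => /andP[u1 u2].
  exists (k, (take k.+1 s, drop k.+1 s)); last by rewrite /= cat_take_drop.
  split; first by rewrite /= -ss.
  split=> /=.
    split=> // -[//|i] /=; rewrite ltnS => ik.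
    by rewrite nth_take ?ltnS 1?ltnW//; have /= -> := before_find u ik.
  split=> //; first by rewrite size_drop ss subSS.
  by rewrite -[RHS]ls -{2}(cat_take_drop k.+1 s) last_cat lk.
Qed.

(** The renewal equation, stated in the extended reals so that infinite counts are covered. *)
Lemma p_renewal u n :
  p_ R u u n.+1 = \sum_(k < n.+1) f_ R u u k.+1 * p_ R u u (n - k).
Proof.
rewrite /p_ counting_esum (reindex_esum _ _ _ _ (first_return_bij u n)).
rewrite -(esum_esum (a := fun _ _ => 1))// esum_fset//; last first.
  by move=> k _; apply: esum_ge0.
by rewrite -fsbig_ord; apply: eq_bigr => k _; rewrite -counting_esum countingX.
Qed.

Lemma le_p_subgraph (G' : graph) (i : G -> G') u v n : injective i ->
  (forall u v : G, arrow u v -> arrow (i u) (i v)) ->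
  p_ R u v n <= p_ R (i u) (i v) n.
Proof.
move=> i_inj i_arrow; apply: (le_counting_inj (f := map i)).
  by move=> s t _ _; exact: inj_map.
move=> s [<- us <-]; split; rewrite ?size_map ?last_map//.
by rewrite path_map; exact: sub_path us.
Qed.

Lemma le_f_subgraph (G' : graph) (i : G -> G') u v n : injective i ->
  (forall u v : G, arrow u v -> arrow (i u) (i v)) ->
  f_ R u v n <= f_ R (i u) (i v) n.
Proof.
move=> i_inj i_arrow; apply: (le_counting_inj (f := map i)).
  by move=> s t _ _; exact: inj_map.
move=> s [[<- us <-] fs]; split; first split; rewrite ?size_map ?last_map//.
  by rewrite path_map; exact: sub_path us.
move=> k /andP[k0 ks]; rewrite -map_cons (nth_map u).
  by rewrite inj_eq// fs// k0.
by rewrite /= ltnW.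
Qed.

End Paths.

(** * Recurrence does not depend on the vertex *)

Section Series.
Context {R : realType}.
Implicit Types (w : nat -> R) (x : R).

(** Translates between the extended-real series that define recurrence and the real partial sums of
    the renewal lemmas. *)
Lemma nneseries_le_sums w x : (forall n, (0 <= w n)%R) ->
  (\sum_(0 <= n <oo) (w n)%:E <= x%:E) <-> sums_le w x.
Proof.
move=> w0; split=> [wx N|wx].
  rewrite -lee_fin -sumEFin -(big_mkord xpredT (fun n => (w n)%:E)).
  apply: le_trans wx; apply: nneseries_lim_ge => n _ _.
  by rewrite lee_fin.
apply: lime_le; first by apply: is_cvg_nneseries => n _ _; rewrite lee_fin.
by apply: nearW => N; rewrite big_mkord sumEFin lee_fin.
Qed.

Lemma nneseries_lty_sums w : (forall n, (0 <= w n)%R) ->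
  (\sum_(0 <= n <oo) (w n)%:E < +oo) <-> exists x, sums_le w x.
Proof.
move=> w0; split=> [wy|[x /(nneseries_le_sums _ w0) wx]]; last first.
  by rewrite (le_lt_trans wx)// ltry.
have ws : \sum_(0 <= n <oo) (w n)%:E \is a fin_num.
  by rewrite ge0_fin_numE// nneseries_ge0// => n _ _; rewrite lee_fin.
by exists (fine (\sum_(0 <= n <oo) (w n)%:E)); apply/nneseries_le_sums; rewrite ?fineK.
Qed.

Lemma nneseries_eq_sums w x : (forall n, (0 <= w n)%R) -> sums_le w x ->
  (forall y, sums_le w y -> (x <= y)%R) -> \sum_(0 <= n <oo) (w n)%:E = x%:E.
Proof.
move=> w0 wx xw; have wy : \sum_(0 <= n <oo) (w n)%:E \is a fin_num.
  rewrite ge0_fin_numE ?nneseries_ge0// => [|n _ _]; last by rewrite lee_fin.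
  by apply/nneseries_lty_sums => //; exists x.
apply/eqP; rewrite eq_le; apply/andP; split; first exact/nneseries_le_sums.
by rewrite -(fineK wy) lee_fin; apply: xw; apply/nneseries_le_sums; rewrite ?fineK.
Qed.

Lemma nneseries_eq_sums_ge w x y : (forall n, (0 <= w n)%R) ->
  \sum_(0 <= n <oo) (w n)%:E = x%:E -> sums_le w y -> (x <= y)%R.
Proof.
by move=> w0 wx wy; rewrite -lee_fin -wx; apply/nneseries_le_sums.
Qed.

Lemma lt_conv_radius (a : nat -> \bar R) (r : R) : (forall n, 0 <= a n) ->
  (0 <= r)%R -> r%:E < conv_radius a ->
  \sum_(0 <= n <oo) a n * (r ^+ n)%:E < +oo.
Proof.
move=> a0 r0 /ereal_sup_gt[_ [t [t0 at_lty] <-]]; rewrite lte_fin => rt.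
apply: le_lt_trans at_lty; apply: lee_nneseries => n _.
  by rewrite mule_ge0// lee_fin exprn_ge0.
by rewrite lee_wpmul2l// lee_fin lerXn2r// ltW.
Qed.

Lemma conv_radius_ge (a : nat -> \bar R) (r : R) :
  (0 <= r)%R -> \sum_(0 <= n <oo) a n * (r ^+ n)%:E < +oo ->
  r%:E <= conv_radius a.
Proof. by move=> r0 ar; apply: ereal_sup_ubound; exists r. Qed.

Lemma eseries_term_lty (a : nat -> \bar R) n : (forall n, 0 <= a n) ->
  \sum_(0 <= n <oo) a n < +oo -> a n < +oo.
Proof.
move=> a0; apply: le_lt_trans.
apply: le_trans (nneseries_lim_ge (m := 0) n.+1 _) => //.
by rewrite big_nat_recr//= leeDr// sume_ge0.
Qed.

End Series.

(** * Path series and the radius of convergence *)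

Section Radius.
Context {R : realType} {G : graph}.
Implicit Types (u v : G) (r rho : R).

Lemma p_ge0 u v n : 0 <= p_ R u v n. Proof. exact: counting_ge0. Qed.

Lemma f_ge0 u v n : 0 <= f_ R u v n. Proof. exact: counting_ge0. Qed.

Lemma p_series_lty u v r : (0 <= r)%R -> r%:E < graph_radius R G ->
  \sum_(0 <= n <oo) p_ R u v n * (r ^+ n)%:E < +oo.
Proof.
move=> r0 rG; apply: lt_conv_radius => //; first by move=> n; exact: p_ge0.
by apply: lt_le_trans rG _; apply: ereal_inf_lbound; exists (u, v).
Qed.

Lemma p_fin_num u v n r : (0 < r)%R -> r%:E < graph_radius R G ->
  p_ R u v n \is a fin_num.
Proof.
move=> r0 rG; have pr0 k : 0 <= p_ R u v k * (r ^+ k)%:E.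
  by rewrite mule_ge0 ?p_ge0// lee_fin exprn_ge0// ltW.
rewrite ge0_fin_numE ?p_ge0// ltey; apply/eqP => pE.
have := eseries_term_lty n pr0 (p_series_lty u v (ltW r0) rG).
by rewrite pE gt0_mulye// lte_fin exprn_gt0.
Qed.

Lemma return_sumE u rho : (0 <= rho)%R -> graph_radius R G = rho%:E ->
  return_sum R u = \sum_(0 <= k <oo) f_ R u u k.+1 * (rho ^+ k.+1)%:E.
Proof.
move=> rho0 rhoE; rewrite /return_sum rhoE -[LHS]nneseries_addn => [|n].
  by apply: eq_eseriesr => n _; rewrite addn1 EFin_expe.
by rewrite mule_ge0 ?f_ge0// -EFin_expe lee_fin exprn_ge0.
Qed.

Lemma return_meanE u rho : (0 <= rho)%R -> graph_radius R G = rho%:E ->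
  return_mean R u =
  \sum_(0 <= k <oo) f_ R u u k.+1 * (k.+1%:R * rho ^+ k.+1)%:E.
Proof.
move=> rho0 rhoE; rewrite /return_mean rhoE -[LHS]nneseries_addn => [|n].
  by apply: eq_eseriesr => n _; rewrite addn1 EFinM EFin_expe muleCA muleA.
by rewrite !mule_ge0 ?f_ge0// -?EFin_expe lee_fin// exprn_ge0.
Qed.

Lemma fine_renewal u : (forall n, p_ R u u n \is a fin_num) ->
  (forall k, f_ R u u k.+1 \is a fin_num) ->
  renewal (fun k => fine (f_ R u u k.+1)) (fun n => fine (p_ R u u n)).
Proof.
move=> p_fin f_fin; split=> [|n]; first by rewrite p_0.
apply: EFin_inj; rewrite fineK// p_renewal -sumEFin.
by apply: eq_bigr => k _; rewrite EFinM !fineK.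
Qed.

Lemma f_fin_num_series u r : (0 < r)%R ->
  \sum_(0 <= k <oo) f_ R u u k.+1 * (r ^+ k.+1)%:E < +oo ->
  forall k, f_ R u u k.+1 \is a fin_num.
Proof.
move=> r0 fr k.
have fr0 n : 0 <= f_ R u u n.+1 * (r ^+ n.+1)%:E.
  by rewrite mule_ge0 ?f_ge0// lee_fin exprn_ge0// ltW.
rewrite ge0_fin_numE ?f_ge0// ltey; apply/eqP => fE.
have := eseries_term_lty k fr0 fr.
by rewrite fE gt0_mulye// lte_fin exprn_gt0.
Qed.

Lemma p_fin_num_f u : (forall k, f_ R u u k.+1 \is a fin_num) ->
  forall n, p_ R u u n \is a fin_num.
Proof.
move=> f_fin n; have [N] := ubnP n; elim: N n => // N ih [|n] nN.
  by rewrite p_0.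
rewrite p_renewal (eq_bigr (fun k : 'I_n.+1 =>
  (fine (f_ R u u k.+1) * fine (p_ R u u (n - k)))%:E)) ?sumEFin// => k _.
by rewrite EFinM !fineK// ih//; lia.
Qed.

(** A return series below 1 at [r] makes the series of loops at [u] finite at [r], by renewal. Fixed
    paths from [u] to [x] and from [y] to [u] complete every path from [x] to [y] into a loop at
    [u], so all path series are finite at [r]. *)
Lemma le_graph_radius u r : connected_graph G -> (0 < r)%R ->
  \sum_(0 <= k <oo) f_ R u u k.+1 * (r ^+ k.+1)%:E < 1 ->
  r%:E <= graph_radius R G.
Proof.
move=> Gconn r0 fr; have f_fin := f_fin_num_series r0 (lt_trans fr (ltry 1)).
have p_fin := p_fin_num_f f_fin.
pose a k := (fine (f_ R u u k.+1) * r ^+ k.+1)%R.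
pose b n := (fine (p_ R u u n) * r ^+ n)%R.
have a0 k : (0 <= a k)%R.
  by rewrite mulr_ge0 ?fine_ge0 ?f_ge0// exprn_ge0// ltW.
have ab : renewal a b.
  apply: (renewal_scale r (a := fun k => fine (f_ R u u k.+1))
    (b := fun n => fine (p_ R u u n))).
  exact: fine_renewal.
have b0 := renewal_ge0 a0 ab.
have frE : \sum_(0 <= k <oo) f_ R u u k.+1 * (r ^+ k.+1)%:E =
    \sum_(0 <= k <oo) (a k)%:E.
  by apply: eq_eseriesr => k _; rewrite EFinM fineK.
set q := fine (\sum_(0 <= k <oo) (a k)%:E).
have qE : \sum_(0 <= k <oo) (a k)%:E = q%:E.
  rewrite fineK// ge0_fin_numE; last first.
    by apply: nneseries_ge0 => k _ _; rewrite lee_fin.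
  by rewrite -frE (lt_trans fr) ?ltry.
have q1 : (q < 1)%R by rewrite -lte_fin -qE -frE.
have bS : sums_le b (1 - q)^-1.
  by apply: renewal_sum_le ab _ q1 => //; apply/nneseries_le_sums; rewrite ?qE.
apply: le_ereal_inf_tmp => _ [[x y] _ <-] /=.
have [m [s ux]] := Gconn u x; have [n [t yu]] := Gconn y u.
have pxy k : p_ R x y k <= p_ R u u (m + (k + n)) by exact: le_p_cat ux yu.
have pxy_fin k : p_ R x y k \is a fin_num.
  rewrite ge0_fin_numE ?p_ge0// (le_lt_trans (pxy k))//.
  by rewrite ltey_eq p_fin.
apply: conv_radius_ge; first exact: ltW.
rewrite (@eq_eseriesr _ _ (fun k => (fine (p_ R x y k) * r ^+ k)%:E)); last first.
  by move=> k _; rewrite EFinM fineK.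
have pr0 k : (0 <= fine (p_ R x y k) * r ^+ k)%R.
  by rewrite mulr_ge0 ?fine_ge0 ?p_ge0// exprn_ge0// ltW.
apply/(nneseries_lty_sums pr0); exists ((1 - q)^-1 / r ^+ (m + n))%R => N.
rewrite ler_pdivlMr ?exprn_gt0//; apply: le_trans (bS ((m + n) + N)%N).
rewrite big_split_ord /= -[leLHS]add0r; apply: lerD; first exact: sumr_ge0.
rewrite mulr_suml; apply: ler_sum => k _; rewrite -mulrA -exprD /b.
rewrite [(k + (m + n))%N]addnC ler_wpM2r ?exprn_ge0 ?(ltW r0)//.
by apply: fine_le => //; rewrite -addnA [(n + k)%N]addnC.
Qed.

Lemma graph_radius_subgraph (G' : graph) : subgraph G G' ->
  graph_radius R G' <= graph_radius R G.
Proof.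
move=> [i [i_inj i_arrow]]; apply: le_ereal_inf_tmp => _ [[x y] _ <-] /=.
apply: (@le_trans _ _ (conv_radius (p_ R (i x) (i y)))).
  by apply: ereal_inf_lbound; exists (i x, i y).
apply: ereal_sup_le => _ [r [r0 pr] <-]; exists r => //; split=> //.
apply: le_lt_trans pr; apply: lee_nneseries => n _.
  by rewrite mule_ge0 ?p_ge0// lee_fin exprn_ge0.
by rewrite lee_wpmul2r ?lee_fin ?exprn_ge0//; exact: le_p_subgraph.
Qed.

End Radius.

Section Recurrence.
Context {R : realType} {G : graph}.
Variable rho : R.
Hypotheses (rho_gt0 : (0 < rho)%R) (rhoE : graph_radius R G = rho%:E).
Hypothesis G_conn : connected_graph G.
Implicit Types (u v : G).

(** [fine] loses nothing here: the radius is positive, so all the counts are finite. *)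
Definition p_weight u n : R := (fine (p_ R u u n) * rho ^+ n)%R.
Definition f_weight u k : R := (fine (f_ R u u k.+1) * rho ^+ k.+1)%R.

Let p_fin u v n : p_ R u v n \is a fin_num.
Proof.
apply: (@p_fin_num _ _ _ _ _ (rho / 2)%R); first by rewrite divr_gt0.
by rewrite rhoE lte_fin ltr_pdivrMr// ltr_pMr// ltr1n.
Qed.

Let f_fin u v n : f_ R u v n \is a fin_num.
Proof.
rewrite ge0_fin_numE ?f_ge0// (le_lt_trans (f_le_p R u v n))//.
by rewrite ltey_eq p_fin.
Qed.

Let pw0 u n : (0 <= p_weight u n)%R.
Proof. by rewrite mulr_ge0 ?fine_ge0 ?p_ge0// exprn_ge0// ltW. Qed.

Let fw0 u n : (0 <= f_weight u n)%R.
Proof. by rewrite mulr_ge0 ?fine_ge0 ?f_ge0// exprn_ge0// ltW. Qed.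

Lemma weight_renewal u : renewal (f_weight u) (p_weight u).
Proof.
apply: (renewal_scale rho (a := fun k => fine (f_ R u u k.+1))
  (b := fun n => fine (p_ R u u n))).
exact: fine_renewal.
Qed.

Lemma return_sum_weight u :
  return_sum R u = \sum_(0 <= k <oo) (f_weight u k)%:E.
Proof.
rewrite (return_sumE u (ltW rho_gt0) rhoE); apply: eq_eseriesr => n _.
by rewrite EFinM fineK.
Qed.

Lemma return_mean_weight u :
  return_mean R u = \sum_(0 <= k <oo) (k.+1%:R * f_weight u k)%:E.
Proof.
rewrite (return_meanE u (ltW rho_gt0) rhoE); apply: eq_eseriesr => n _.
by rewrite /f_weight mulrCA [in RHS]EFinM fineK.
Qed.

(** The path series converges at [rho * s] for every [s < 1], which is what [renewal_return_le1]
    asks for. *)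
Lemma f_weight_sum_le1 u : sums_le (f_weight u) 1.
Proof.
apply: (renewal_return_le1 (fw0 u) (weight_renewal u)) => s /andP[s0 s1].
have psw0 n : (0 <= p_weight u n * s ^+ n)%R by rewrite mulr_ge0// exprn_ge0// ltW.
apply/(nneseries_lty_sums psw0).
have := @p_series_lty R G u u (rho * s)%R; rewrite mulr_ge0 ?ltW// rhoE lte_fin.
rewrite gtr_pMr// => /(_ isT s1).
congr (_ < _); apply: eq_eseriesr => n _.
by rewrite /p_weight -mulrA -exprMn EFinM fineK.
Qed.

(** Fixed paths from [v] to [u] and from [u] to [v], put around a loop at [u], give a loop at [v];
    [d] is their total length and [c] is [rho ^+ d]. *)
Lemma p_weight_transfer u v : exists c d, (0 < c)%R /\
  forall n, (c * p_weight u n <= p_weight v (n + d)%N)%R.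
Proof.
have [a [s vs]] := G_conn v u; have [b [t ut]] := G_conn u v.
exists (rho ^+ (a + b))%R, (a + b)%N; split=> [|n]; first by rewrite exprn_gt0.
rewrite /p_weight mulrC -mulrA -exprD ler_wpM2r ?exprn_ge0 ?(ltW rho_gt0)//.
by apply: fine_le => //; rewrite addnCA; exact: le_p_cat vs ut.
Qed.

Lemma return_sum_eq1 u v : return_sum R u = 1 -> return_sum R v = 1.
Proof.
have [c [d [c0 cd]]] := p_weight_transfer u v.
rewrite !return_sum_weight => u1; apply: nneseries_eq_sums => // [|x].
  exact: f_weight_sum_le1.
apply: (renewal_recurrent_transfer _ _ (weight_renewal u) (weight_renewal v)
  c0 cd) => //.
by move=> y; exact: nneseries_eq_sums_ge.
Qed.

Lemma return_mean_lty u v : return_sum R u = 1 -> return_mean R u < +oo ->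
  return_mean R v < +oo.
Proof.
have [c [d [c0 cd]]] := p_weight_transfer u v.
rewrite return_sum_weight !return_mean_weight => u1.
have mw0 w n : (0 <= n.+1%:R * f_weight w n)%R by rewrite mulr_ge0.
move=> /(nneseries_lty_sums (mw0 u))[m um].
apply/(nneseries_lty_sums (mw0 v)); exists (m / c)%R.
apply: (renewal_mean_transfer _ _ (weight_renewal u) (weight_renewal v)
  c0 cd) => //.
  by move=> y; exact: nneseries_eq_sums_ge.
exact: f_weight_sum_le1.
Qed.

Lemma positive_recurrentP u : return_sum R u = 1 -> return_mean R u < +oo ->
  positive_recurrent R G.
Proof.
move=> u1 um; split=> // v; split; first exact: return_sum_eq1 u1.
exact: return_mean_lty um.
Qed.

Lemma recurrentP u : return_sum R u = 1 -> recurrent R G.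
Proof.
move=> u1; have [um|um] := ltP (return_mean R u) +oo.
  by right; exact: positive_recurrentP um.
left; split=> // v; have v1 := return_sum_eq1 v u1; split=> //.
apply/eqP; rewrite -leye_eq leNgt; apply/negP => /(return_mean_lty u v1).
by rewrite ltNge um.
Qed.

End Recurrence.

(** * Attaching loops to a vertex *)

Section Extension.
Variables (G : graph) (u0 : G) (c : nat -> nat).

(* Besides [G], one vertex for each lane [j < c n] and each position [k <= n]:
   lane [j] is a loop of length [n.+2] based at [u0]. *)
Let lane_vertex := {n : nat & ('I_(c n) * 'I_n.+1)%type}.
Definition ext_vertex : countType := (G + lane_vertex)%type.

Implicit Types t : lane_vertex.

Let pos t : nat := (tagged t).2.

(** Lane numbers are compared as natural numbers because their type ['I_(c n)] varies with [n]. *)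
Definition ext_arrow : rel ext_vertex := fun x y =>
  match x, y with
  | inl u, inl v => arrow u v
  | inl u, inr t => (u == u0) && (pos t == 0%N)
  | inr t, inl v => (pos t == tag t) && (v == u0)
  | inr t, inr t' => [&& tag t' == tag t, (tagged t').1 == (tagged t).1 :> nat
                       & pos t' == (pos t).+1]
  end.

Definition extension : graph := @Graph ext_vertex ext_arrow.

(** [inord] yields position [k] only for [k <= tag t]; all uses stay in that range. *)
Let at_pos t k : lane_vertex := existT _ (tag t) ((tagged t).1, inord k).

(* The way from [t] to [u0] along its lane, without its origin [t]. *)
Let tail t : seq extension :=
  rcons [seq inr (at_pos t k) | k <- iota (pos t).+1 (tag t - pos t)%N] (inl u0).

Let lane_vertex_eq t t' : tag t' = tag t ->
  (tagged t').1 = (tagged t).1 :> nat -> t' = at_pos t (pos t').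
Proof.
case: t t' => [n [j k]] [n' [j' k']] /= nn'; rewrite /at_pos /pos /=.
case: n / nn' j k => j k /= jj'; rewrite inord_val.
by have -> : j' = j by exact: val_inj.
Qed.

Let at_pos_id t : at_pos t (pos t) = t.
Proof. by apply/esym/lane_vertex_eq. Qed.

Let pos_at t k : (k <= tag t)%N -> pos (at_pos t k) = k.
Proof. by move=> kt; rewrite /pos /= inordK. Qed.

Let pos_le t : (pos t <= tag t)%N.
Proof. by rewrite -ltnS; exact: ltn_ord. Qed.

Let lane_path t k m : (k + m <= tag t)%N ->
  path ext_arrow (inr (at_pos t k)) [seq inr (at_pos t i) | i <- iota k.+1 m] /\
  last (inr (at_pos t k) : extension) [seq inr (at_pos t i) | i <- iota k.+1 m]
    = inr (at_pos t (k + m)%N).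
Proof.
elim: m k => [|m ih] k kmt; first by rewrite addn0.
have [|p l] := ih k.+1; first by lia.
split; last by rewrite /= l addnS.
by apply/andP; split=> //=; rewrite !eqxx !pos_at ?eqxx//; lia.
Qed.

Let tail_paths t : paths (inr t : extension) (inl u0) (tag t - pos t).+1%N (tail t).
Proof.
have [|p l] := @lane_path t (pos t) (tag t - pos t)%N; first by have := pos_le t; lia.
rewrite at_pos_id in p l.
split; rewrite ?last_rcons ?size_rcons ?size_map ?size_iota//.
rewrite rcons_path p /= l /= eqxx pos_at subnKC ?eqxx//.
Qed.

(** A lane vertex has a single outgoing arrow, so the path is forced until it reaches [u0]. *)
Let tail_unique t s : path ext_arrow (inr t) (rcons s (inl u0)) ->
  (inl u0 : extension) \notin s -> rcons s (inl u0) = tail t.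
Proof.
elim: s t => [|[v|t'] s ih] t /=.
- by rewrite andbT eqxx andbT => /eqP tt _; rewrite /tail tt subnn.
- by move=> /andP[/andP[_ /eqP->] _]; rewrite in_cons eqxx.
- move=> /andP[/and3P[/eqP tt' /eqP jj' /eqP kk'] st'].
  rewrite in_cons /= => us; rewrite (ih t')//.
  have t'E := lane_vertex_eq tt' jj'.
  rewrite /tail -[in LHS]/(tag t') tt' kk'.
  have -> : (tag t - pos t = (tag t - (pos t).+1).+1)%N.
    by have := pos_le t'; rewrite tt' kk'; lia.
  rewrite /= -kk' -t'E; congr (_ :: rcons _ _); apply: eq_map => k.
  by rewrite [in LHS]t'E.
Qed.

Let start n (j : 'I_(c n)) : lane_vertex := existT _ n (j, ord0).

Definition loop n (j : 'I_(c n)) : seq extension := inr (start j) :: tail (start j).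

Let loop_first_path n (j : 'I_(c n)) :
  first_paths (inl u0 : extension) (inl u0) n.+2 (loop j).
Proof.
have [] := tail_paths (start j); rewrite subn0 => st pt lt.
apply/first_pathsP; eexists; split.
- by rewrite /loop /tail -rcons_cons.
- by rewrite /= size_map size_iota subn0.
- by rewrite /= eqxx.
- by rewrite in_cons /=; apply/mapP => -[].
Qed.

(** Arrows from [G] into a lane start at [u0] only. *)
Let path_in_graph x s : x != u0 -> path ext_arrow (inl x) (rcons s (inl u0)) ->
  (inl u0 : extension) \notin s -> exists s', s = map inl s'.
Proof.
elim: s x => [|[v|t] s ih] x xu0 /=; first by exists [::].
- move=> /andP[_ vs]; rewrite in_cons => /norP[uv us].
  have [|s' ->] := ih v _ vs us; last by exists (v :: s').
  by apply: contraNneq uv => ->.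
- by rewrite (negPf xu0).
Qed.

(** The first vertex after [u0] decides: from another vertex of [G] no lane can be entered before
    the return, and inside a lane the path must run to its end. An empty interior is an arrow from
    [u0] to itself. *)
Lemma ext_first_paths n : first_paths (inl u0 : extension) (inl u0) n.+1 =
  (map inl @` first_paths u0 u0 n.+1) `|`
  (if n is m.+1 then range (@loop m) else set0).
Proof.
apply/seteqP; split=> s.
- move=> /first_pathsP[s' [-> ss us vs]].
  have G_case r : s' = map inl r ->
      (map inl @` first_paths u0 u0 n.+1) (rcons s' (inl u0)).
    move=> s'E; exists (rcons r u0); last by rewrite map_rcons s'E.
    apply/first_pathsP; exists r; split=> //.
    + by rewrite -ss s'E size_map.
    + by move: us; rewrite s'E -map_rcons path_map.
    + by apply: contra vs; rewrite s'E; exact: map_f.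
  case: s' ss us vs G_case => [|[v|t] s'] ss us vs G_case.
  + by left; apply: (G_case [::]).
  + left; move: vs us; rewrite in_cons => /norP[uv vs] /= /andP[_ us].
    have [|r rE] := path_in_graph _ us vs; first by apply: contraNneq uv => ->.
    by apply: (G_case (v :: r)); rewrite rE.
  (* A lane is entered at position 0, so the path is the whole loop and its length determines
     [tag t]. *)
  + right; move: us => /= /andP[/andP[_ /eqP t0] ts].
    have sE := tail_unique ts vs.
    have := congr1 size sE; rewrite !size_rcons size_map size_iota t0 subn0 => -[st].
    rewrite -ss /= st sE; exists (tagged t).1 => //; rewrite /loop.
    suff -> : start (tagged t).1 = t by [].
    rewrite /start -[in RHS](at_pos_id t) t0 /at_pos; congr existT; congr pair.
    by apply: val_inj; rewrite /= inordK.
- case=> [[r /first_pathsP[r' [-> rs ur vr]] <-]|].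
    apply/first_pathsP; exists (map inl r'); rewrite map_rcons size_map; split=> //.
      by rewrite -map_rcons path_map.
    by apply/mapP => -[y yr [yE]]; rewrite yE yr in vr.
  by case: n => // n [j _ <-]; exact: loop_first_path.
Qed.

Lemma f_extension (R : realType) n : f_ R (inl u0 : extension) (inl u0) n.+1 =
  f_ R u0 u0 n.+1 + (if n is m.+1 then (c m)%:R%:E else 0).
Proof.
rewrite /f_ ext_first_paths countingU; last first.
  apply/disj_set2P; rewrite -subset0 => _ [[s _ <-]].
  by case: n => // n [j _]; rewrite /loop; case: s.
congr (_ + _); first by apply: counting_image => s t _ _; apply: inj_map => x y [].
case: n => [|n]; first by rewrite counting_set0.
rewrite counting_image ?counting_ord// => j j' _ _ [] jj' _.
apply/val_inj.
by have := congr1 (fun t : {n : nat & 'I_(c n)} => nat_of_ord (tagged t)) jj'.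
Qed.

Lemma subgraph_extension : subgraph G extension.
Proof. by exists inl; split=> // x y []. Qed.

Lemma paths_extension u v n s :
  paths u v n s -> paths (inl u : extension) (inl v) n (map inl s).
Proof.
move=> [ss us vs]; split; rewrite ?size_map// ?last_map ?vs//.
by rewrite path_map.
Qed.

Lemma extension_connected : connected_graph G -> connected_graph extension.
Proof.
move=> Gconn x y.
have [m [s xu]] : exists m, paths x (inl u0 : extension) m !=set0.
  case: x => [v|t]; last by eexists; exists (tail t); exact: tail_paths.
  by have [n [s vu]] := Gconn v u0; exists n, (map inl s); exact: paths_extension.
have [n [r uy]] : exists n, paths (inl u0 : extension) y n !=set0.
  case: y => [v|t].
    by have [n [r vu]] := Gconn u0 v; exists n, (map inl r); exact: paths_extension.
  have [|p l] := @lane_path t 0%N (pos t); first by have := pos_le t; lia.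
  exists (pos t).+1, (inr (at_pos t 0%N) ::
    [seq inr (at_pos t k) | k <- iota 1%N (pos t)]).
  split=> /=; rewrite ?size_map ?size_iota//; last by rewrite l add0n at_pos_id.
  by rewrite eqxx pos_at.
by exists (m + n)%N, (s ++ r); exact: paths_cat uy.
Qed.

End Extension.

Section RecurrentExtension.
Context {R : realType} {G : graph}.
Implicit Types (u v : G).

(** The weight [z] is left general to serve both the return sum and the mean; the [c k] loops of
    length [k.+2] carry weight [z k.+1]. *)
Lemma extension_series u (c : nat -> nat) (z : nat -> R) :
  (forall k, (0 <= z k)%R) ->
  \sum_(0 <= k <oo)
     f_ R (inl u : extension u c) (inl u) k.+1 * (z k)%:E =
  \sum_(0 <= k <oo) f_ R u u k.+1 * (z k)%:E +
  \sum_(0 <= k <oo) ((c k)%:R * z k.+1)%:E.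
Proof.
move=> z0; pose d k : R := (if k is m.+1 then (c m)%:R else 0)%R.
have d0 k : (0 <= d k)%R by case: k => [|k] /=.
transitivity (\sum_(0 <= k <oo) (f_ R u u k.+1 * (z k)%:E + (d k * z k)%:E)).
  apply: eq_eseriesr => k _; rewrite f_extension EFinM -ge0_muleDl ?f_ge0//.
    by case: k.
  by rewrite lee_fin.
rewrite nneseriesD; last 2 first.
- by move=> k _ _; rewrite mule_ge0 ?f_ge0// lee_fin.
- by move=> k _ _; rewrite lee_fin mulr_ge0.
congr (_ + _); rewrite nneseries_recl//; last first.
  by move=> k _; rewrite lee_fin mulr_ge0.
rewrite /= mul0r add0e -nneseries_addn => [|k]; last by rewrite lee_fin mulr_ge0.
by apply: eq_eseriesr => k _; rewrite addn1.
Qed.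

Lemma le_of_forall_lt (rho : R) (x : \bar R) : (0 < rho)%R ->
  (forall r, (0 < r < rho)%R -> r%:E <= x) -> rho%:E <= x.
Proof.
move=> rho0 rx; case: x rx => [x| |] rx; last 2 first.
- exact: leey.
- have := rx (rho / 2)%R; rewrite divr_gt0//= ltr_pdivrMr// ltr_pMr// ltr1n.
  by move=> /(_ isT).
rewrite lee_fin leNgt; apply/negP => xrho.
have x0 : (0 < x)%R.
  have := rx (rho / 2)%R; rewrite divr_gt0//= ltr_pdivrMr// ltr_pMr// ltr1n lee_fin.
  by move=> /(_ isT); apply: lt_le_trans; rewrite divr_gt0.
have := rx ((x + rho) / 2)%R; rewrite lee_fin midf_lt//= divr_gt0 ?addr_gt0//.
by move=> /(_ isT); rewrite leNgt midf_lt.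
Qed.

Lemma recurrent_extension u (rho : R) : connected_graph G ->
  (0 < rho < 1)%R -> graph_radius R G = rho%:E -> return_sum R u < 1 ->
  exists G', [/\ subgraph G G', connected_graph G',
    graph_radius R G' = rho%:E, recurrent R G' &
    return_mean R u < +oo -> positive_recurrent R G'].
Proof.
move=> Gconn /andP[rho0 rho1] rhoE u1.
have sE := return_sumE u (ltW rho0) rhoE.
have mE := return_meanE u (ltW rho0) rhoE.
have s0 : 0 <= return_sum R u.
  rewrite sE nneseries_ge0// => k _ _.
  by rewrite mule_ge0 ?f_ge0// lee_fin exprn_ge0// ltW.
pose F := fine (return_sum R u).
have FE : return_sum R u = F%:E.
  by rewrite fineK// ge0_fin_numE// (lt_trans u1)// ltry.
have F1 : (0 <= 1 - F)%R by rewrite subr_ge0 -lee_fin -FE ltW.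
(* The digits expand the missing mass [1 - F] in powers of [rho]. *)
have [|c [cF Fc [m cm]]] := digit_expansion F1 (r := rho); first by rewrite rho0.
have c0 k : (0 <= (c k)%:R * rho ^+ k.+2)%R by rewrite mulr_ge0// exprn_ge0// ltW.
set v : extension u c := inl u.
have v1 : \sum_(0 <= k <oo) f_ R v v k.+1 * (rho ^+ k.+1)%:E = 1.
  rewrite extension_series => [|k]; last by rewrite exprn_ge0// ltW.
  rewrite (nneseries_eq_sums c0 cF Fc) -sE FE -EFinD.
  by rewrite addrCA subrr addr0.
have Gsub := @subgraph_extension G u c.
have G'conn := @extension_connected _ u c Gconn.
have G'rho : graph_radius R (extension u c) = rho%:E.
  apply/eqP; rewrite eq_le -{1}rhoE.
  rewrite (graph_radius_subgraph Gsub)//=.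
  apply: le_of_forall_lt => // r /andP[r0 rrho].
  apply: (le_graph_radius (u := v) G'conn r0).
  (* All returns have length at least 1, so the return series at [r] is at most [r / rho] times its
     value 1 at [rho]. *)
  apply: (@le_lt_trans _ _ (r / rho)%:E); last first.
    by rewrite lte_fin ltr_pdivrMr// mul1r.
  rewrite -[leRHS]mule1 -v1 -nneseriesZl => [|k _]; last first.
    by rewrite mule_ge0 ?f_ge0// lee_fin exprn_ge0// ltW.
  apply: lee_nneseries => k _.
    by rewrite mule_ge0 ?f_ge0// lee_fin exprn_ge0// ltW.
  rewrite muleCA lee_wpmul2l ?f_ge0// -EFinM lee_fin.
  rewrite -[leLHS](mulfVK (x := rho ^+ k.+1)) ?gt_eqF ?exprn_gt0//.
  rewrite ler_wpM2r ?exprn_ge0 ?(ltW rho0)// -expr_div_n exprS.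
  rewrite ler_piMr ?divr_ge0 ?(ltW r0) ?(ltW rho0)//.
  rewrite exprn_ile1 ?divr_ge0 ?(ltW r0) ?(ltW rho0)//.
  by rewrite ler_pdivrMr// mul1r ltW.
exists (extension u c); split=> //.
- apply: (recurrentP rho0 G'rho G'conn (u := v)).
  by rewrite (return_sumE v (ltW rho0) G'rho).
- move=> um; apply: (positive_recurrentP rho0 G'rho G'conn (u := v)).
    by rewrite (return_sumE v (ltW rho0) G'rho).
  rewrite (return_meanE v (ltW rho0) G'rho) extension_series => [|k]; last first.
    by rewrite mulr_ge0// exprn_ge0// ltW.
  rewrite lte_add_pinfty// -?mE//.
  have cm0 k : (0 <= (c k)%:R * (k.+2%:R * rho ^+ k.+2))%R.
    by rewrite mulr_ge0// mulr_ge0// exprn_ge0// ltW.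
  apply/(nneseries_lty_sums cm0); exists m => N; apply: le_trans (cm N).
  by under eq_bigr do rewrite mulrCA.
Qed.

End RecurrentExtension.

(** * Entropy and radius of convergence *)

Section Cylinders.
Variable G : graph.
Implicit Types (x y : bisequence G) (m n : nat).

Definition cylinder x m : set (bisequence G) :=
  [set y | forall i : int, (`|i| <= m)%N -> y i = x i].

Lemma cylinder_le x m n : (m <= n)%N -> cylinder x n `<=` cylinder x m.
Proof. by move=> mn y xy i im; apply: xy; exact: leq_trans mn. Qed.

Lemma coord_nbhs x (i : int) : nbhs x [set y : bisequence G | y i = x i].
Proof.
have := @proj_continuous int (fun=> discrete_topology G) i x.
by move=> /(_ [set x i]); apply; exact: discrete_set1.
Qed.

Lemma cylinder_nbhs x m : nbhs x (cylinder x m).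
Proof.
elim: m => [|m ih].
  apply: filterS (coord_nbhs x 0%R) => y y0 i.
  by rewrite leqn0 absz_eq0 => /eqP ->.
apply: filterS (filterI ih (filterI (coord_nbhs x (Posz m.+1))
  (coord_nbhs x (Negz m)))) => y [yx [yp yn]] i.
rewrite leq_eqVlt => /orP[/eqP im|]; last by rewrite ltnS; exact: yx.
by case: i im => i /= => [->|[->]].
Qed.

(** The cylinders at [x] generate a filter converging to [x], since convergence in the product is
    tested one coordinate at a time. *)
Lemma nbhs_cylinder x (A : set (bisequence G)) : nbhs x A ->
  exists m, cylinder x m `<=` A.
Proof.
pose F := filter_from [set: nat] (cylinder x).
have FF : Filter F.
  apply: filter_from_filter; first by exists 0%N.
  move=> m n _ _; exists (maxn m n) => // y xy; split.
    by apply: cylinder_le xy; exact: leq_maxl.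
  by apply: cylinder_le xy; exact: leq_maxr.
have Fx : F --> x.
  apply/cvg_sup => i U [V [[W oW <-] Wxi] WU].
  by exists `|i|%N => // y xy; apply: WU; rewrite /= xy.
by move=> /Fx[m _ mA]; exists m.
Qed.

(** A Lebesgue number for the cover, with cylinders in place of balls. *)
Lemma cylinder_cover (K : set (bisequence G)) (U : set (set (bisequence G))) :
  compact K -> open_cover K U ->
  exists m, forall x, K x -> exists2 A, U A & cylinder x m `<=` A.
Proof.
move=> /compact_near_coveringP cK [Uo KU].
have [|m _ /(_ m (leqnn m)) KmU] := cK nat \oo
    (fun m x => exists2 A, U A & cylinder x m `<=` A); last by exists m.
move=> x /KU[A UA Ax]; have /nbhs_cylinder[m xA] : nbhs x A.
  by apply: open_nbhs_nbhs; split=> //; exact: Uo.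
exists (cylinder x m, [set n | (m <= n)%N]) => /=.
  by split; [exact: cylinder_nbhs | exists m].
move=> [y n] /= [xy mn]; exists A => // z yz; apply: xA => i im.
by rewrite yz ?xy// (leq_trans im).
Qed.

(** Tychonoff gives compactness of the full space. The set is closed because the condition at time
    [i] involves only the coordinates [i] and [i + 1]. *)
Lemma two_sided_paths_compact : finite_graph G -> compact (@two_sided_paths G).
Proof.
move=> fG; apply: (subclosed_compact _ _ (B := setT)) => //.
  move=> x clx i; have [y [Ky yx]] := clx _ (cylinder_nbhs x `|i|.+1).
  have := Ky i; rewrite !yx//; first by lia.
have := @tychonoff int (fun=> discrete_topology G) (fun=> setT).
rewrite (_ : [set f | forall i, setT (f i)] = setT); last first.
  by apply/seteqP; split.
apply=> i; exact: finite_compact.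
Qed.

End Cylinders.

(** * Upper bound of the entropy by counting paths *)

Section UpperBound.
Context {R : realType}.

Lemma counting_image_le (T T' : choiceType) (f : T -> T') (A : set T) :
  counting (f @` A) <= counting A :> \bar R.
Proof.
have [fA|iA] := pselect (finite_set A); last by rewrite (counting_infinite iA) leey.
rewrite !counting_finite//; last exact: finite_image.
by rewrite lee_fin ler_nat fset_set_image// leq_imfset_card.
Qed.

Variable H : graph.
Implicit Types (x y : bisequence H) (m n N : nat).

Let K := @two_sided_paths H.

Lemma iter_shift x n (i : int) : iter n (@shift H) x i = x (i + n%:Z)%R.
Proof.
elim: n i => [|n ih] i; first by rewrite addr0.
by rewrite iterS /shift ih -addrA; congr (x (_ + _)%R); lia.
Qed.

Lemma iter_shift_two_sided x n : K x -> K (iter n (@shift H) x).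
Proof. by move=> Kx i; rewrite !iter_shift addrAC; exact: Kx. Qed.

(* The path followed by [x] between the times [- m] and [L - m]. *)
Let window m L x : H * seq H :=
  (x (- m%:Z)%R : H, mkseq (fun k => x (- m%:Z + k.+1%:Z)%R : H) L).

Let window_eq m L x y (i : int) : window m L x = window m L y ->
  (- m%:Z <= i <= - m%:Z + L%:Z)%R -> x i = y i.
Proof.
move=> [xym xyL] /andP[mi iL].
have [k ik] : exists k : nat, (i = - m%:Z + k%:Z)%R.
  by exists `|(i + m%:Z)%R|%N; lia.
case: k ik => [|k] ik; rewrite ik; first by rewrite addr0.
have kL : (k < L)%N by lia.
have := congr1 (fun s => nth (x (- m%:Z)%R : H) s k) xyL.
by rewrite !nth_mkseq.
Qed.

Let window_path m L x :
  K x -> path (@arrow H) (window m L x).1 (window m L x).2.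
Proof.
move=> Kx; apply/(pathP (x (- m%:Z)%R : H)) => i; rewrite size_mkseq => iL.
rewrite nth_mkseq//=; case: i iL => [|i] iL /=.
  by have := Kx (- m%:Z)%R.
rewrite nth_mkseq//; last exact: ltnW.
have := Kx (- m%:Z + i.+1%:Z)%R; rewrite -addrA; congr arrow.
by congr (x (_ + _)%R); lia.
Qed.

(** Points with the same window share their cylinders of radius [m] during [N] steps, so one member
    of the join per window suffices. *)
Lemma min_subcover_le (U : set (set (bisequence H))) m N :
  (forall x, K x -> exists2 A, U A & cylinder x m `<=` A) ->
  min_subcover R K (iter_join (@shift H) U N) <=
  counting [set us : H * seq H | size us.2 = (N + m.*2)%N /\
                                 path (@arrow H) us.1 us.2].
Proof.
move=> KU; pose w := window m (N + m.*2).
have /choice[B BP] (e : H * seq H) : exists B,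
    (exists2 x, K x & w x = e) -> iter_join (@shift H) U N B /\
    forall x, K x -> w x = e -> B x.
  (* Words that are not windows of points of [K] get the dummy value [set0]; they stay out of the
     subcover. *)
  have [[x Kx xe]|ne] := pselect (exists2 x, K x & w x = e); last by exists set0.
  have /choice[A AP] (i : nat) :
      exists A, U A /\ cylinder (iter i (@shift H) x) m `<=` A.
    by have [A] := KU _ (@iter_shift_two_sided x i Kx); exists A.
  exists (\bigcap_(i in `I_N) (iter i (@shift H) @^-1` A i)) => _.
  split; first by exists A => // i _; have [] := AP i.
  move=> y Ky ye i /= iN; apply: (AP i).2 => j jm.
  rewrite !iter_shift; apply: (@window_eq m (N + m.*2)); first by rewrite -/w xe ye.
  lia.
apply: (@le_trans _ _ (counting (B @` (w @` K)))).
  apply: ereal_inf_lbound; exists (B @` (w @` K)) => //; split.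
    by move=> _ [e [x Kx xe] <-]; apply: (BP e _).1; exists x.
  move=> x Kx; exists (B (w x)); first by exists (w x) => //; exists x.
  by apply: (BP (w x) _).2 => //; exists x.
apply: le_trans (counting_image_le _ _) _; apply: le_counting.
move=> _ [x Kx <-]; split; first by rewrite /= size_mkseq.
exact: window_path.
Qed.

Lemma counting_all_paths_le L (c : R) : finite_graph H ->
  (forall u v : H, p_ R u v L <= c%:E) ->
  counting [set us : H * seq H | size us.2 = L /\ path (@arrow H) us.1 us.2]
    <= (#|` fset_set [set: H * H]|%:R * c)%:E.
Proof.
move=> fH pc; have fHH : finite_set [set: H * H].
  by rewrite -setXTT; exact: finite_setX.
apply: (@le_trans _ _ (counting ([set: H * H] `*`` (fun uv => paths uv.1 uv.2 L)))).
  apply: (le_counting_inj (f := fun us : H * seq H =>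
    ((us.1, last us.1 us.2), us.2))).
    by move=> [u s] [v t] _ _ /= [-> _ ->].
  by move=> [u s] [sL us]; split.
rewrite counting_esum -(esum_esum (a := fun _ _ => 1))//.
apply: (@le_trans _ _ (\esum_(uv in [set: H * H]) c%:E)).
  by apply: le_esum => -[u v] _; rewrite -counting_esum; exact: pc.
rewrite esum_fset//; last first.
  by move=> [u v] _; apply: le_trans (pc u v); exact: counting_ge0.
rewrite fsbig_finite//= sumEFin big_const_seq count_predT iter_addr addr0.
by rewrite mulr_natl.
Qed.

End UpperBound.

Section EntropyUpperBound.
Context {R : realType}.

Lemma limn_esup_le (u : nat -> \bar R) (c : \bar R) k :
  (forall N, (k <= N)%N -> u N <= c) -> limn_esup u <= c.
Proof.
move=> uc; apply: (@le_trans _ _ (ereal_sup (u @` [set N | (k <= N)%N]))).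
  by apply: ereal_inf_lbound; exists [set N | (k <= N)%N] => //; exists k.
by apply: ge_ereal_sup => _ [N kN <-]; exact: uc.
Qed.

Lemma le_limn_esup (u : nat -> \bar R) (c : \bar R) :
  (forall k, exists2 N, (k <= N)%N & c <= u N) -> c <= limn_esup u.
Proof.
move=> uc; apply: le_ereal_inf_tmp => _ [A [k _ kA] <-].
have [N kN cN] := uc k; apply: le_trans cN _.
by apply: ereal_sup_ubound; exists N => //; exact: kA.
Qed.

Lemma finite_ubound (T : choiceType) (f : T -> R) : finite_set [set: T] ->
  exists c, forall x, (f x <= c)%R.
Proof.
move=> /finite_seqP[s sT]; exists (\sum_(x <- s) `|f x|)%R => x.
have xs : x \in s by have : [set: T] x by []; rewrite sT.
apply: le_trans (ler_norm _) _; rewrite (big_rem x)//= lerDl.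
by apply: sumr_ge0.
Qed.

Lemma min_subcover_ge0 (T : topologicalType) (K : set T) U :
  0 <= min_subcover R K U.
Proof. by apply: le_ereal_inf_tmp => _ [W _ <-]; exact: counting_ge0. Qed.

(** The terms of a series convergent at [r] are bounded, so paths of length [L] number at most
    [C * r ^- L], uniformly over the finitely many pairs of endpoints in [H]. Logarithms divided by
    time leave [- ln r]. *)
Lemma entropy_le (G : graph) (r : R) : (0 < r)%R ->
  r%:E < graph_radius R G -> entropy R G <= (- ln r)%:E.
Proof.
move=> r0 rG; apply: ge_ereal_sup => _ [H [fH [i [i_inj i_arrow]] ->]].
apply: ge_ereal_sup => _ [U KU <-].
have [m mU] := cylinder_cover (two_sided_paths_compact fH) KU.
pose S (uv : H * H) := fine
  (\sum_(0 <= n <oo) p_ R (i uv.1) (i uv.2) n * (r ^+ n)%:E).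
have [C SC] : exists C, forall uv, (S uv <= C)%R.
  by apply: finite_ubound; rewrite -setXTT; exact: finite_setX.
have pC L (u v : H) : p_ R u v L <= (C * r ^- L)%:E.
  apply: le_trans (le_p_subgraph _ _ _ _ i_inj i_arrow) _.
  have pr0 n : 0 <= p_ R (i u) (i v) n * (r ^+ n)%:E.
    by rewrite mule_ge0 ?p_ge0// lee_fin exprn_ge0// ltW.
  have pry := p_series_lty (i u) (i v) (ltW r0) rG.
  rewrite EFinM lee_pdivlMr ?exprn_gt0//.
  apply: (@le_trans _ _ (S (u, v))%:E); last by rewrite lee_fin SC.
  rewrite fineK; last by rewrite ge0_fin_numE// nneseries_ge0.
  apply: le_trans (nneseries_lim_ge (m := 0) L.+1 _) => //.
  by rewrite big_nat_recr//= leeDr// sume_ge0.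
(* The absolute value and the added 1 make [D] positive, as the logarithm requires, even for an
   empty [H]. *)
pose D := (#|` fset_set [set: H * H]|%:R * `|C| + 1)%R.
have D0 : (0 < D)%R by rewrite ltr_wpDl// mulr_ge0.
have minD N : min_subcover R (@two_sided_paths H) (iter_join (@shift H) U N) <=
    (D * r ^- (N + m.*2))%:E.
  apply: le_trans (min_subcover_le N mU) _.
  apply: le_trans (counting_all_paths_le fH (pC _)) _.
  rewrite lee_fin mulrA ler_wpM2r ?invr_ge0 ?exprn_ge0 ?(ltW r0)//.
  rewrite (le_trans (y := (#|` fset_set [set: H * H]|%:R * `|C|)%R))//.
    by rewrite ler_wpM2l// ler_norm.
  by rewrite lerDl.
(* The logarithm of the bound is [E - N * ln r], and [E] is at most [e * N] once [N] passes the
   threshold chosen below. *)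
pose E := (ln D - m.*2%:R * ln r)%R.
apply/lee_addgt0Pr => e e0.
apply: (@limn_esup_le _ _ (Num.truncn (`|E| / e)).+1) => N EN.
have N0 : (0 < N%:R :> R)%R by rewrite ltr0n (leq_trans _ EN).
apply: (@le_trans _ _ ((N%:R^-1)%:E * (lne (D * r ^- (N + m.*2))%:E))).
  rewrite lee_wpmul2l ?lee_fin ?invr_ge0 ?(ltW N0)// lee_lne ?minD//.
    by rewrite in_itv /= min_subcover_ge0 leey.
  rewrite in_itv /= leey lee_fin mulr_ge0 ?(ltW D0)// invr_ge0 exprn_ge0// ltW//.
rewrite lne_EFin; last by rewrite mulr_gt0// invr_gt0 exprn_gt0.
rewrite -EFinM -EFinD lee_fin lnM ?posrE ?invr_gt0 ?exprn_gt0//.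
rewrite lnV ?posrE ?exprn_gt0// lnXn//.
have EeN : (`|E| <= e * N%:R)%R.
  rewrite mulrC -ler_pdivrMr//.
  have /andP[_ /ltW En] := truncn_itv (divr_ge0 (normr_ge0 E) (ltW e0)).
  by apply: le_trans En _; rewrite ler_nat.
rewrite mulrC ler_pdivrMr// mulrDl -[(ln r *+ _)%R]mulr_natl natrD.
have := le_trans (ler_norm E) EeN; rewrite /E; lra.
Qed.

End EntropyUpperBound.

(** * Free concatenation of loops of equal length in a finite subgraph *)

Section LoopSystem.
Context {R : realType}.
Variables (G : graph) (u : G) (n M : nat) (P : 'I_M.+1 -> seq G).
Hypotheses (n_gt0 : (0 < n)%N) (P_inj : injective P).
Hypothesis uP : forall a, paths u u n (P a).

Let support : seq G := u :: flatten [seq P a | a : 'I_M.+1].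

Definition loop_vertex : countType := seq_sub support.

Definition loop_graph : graph :=
  @Graph loop_vertex (fun x y => arrow (ssval x) (ssval y)).

Local Notation H := loop_graph.

Lemma loop_graph_finite : finite_graph H.
Proof. exact: (@finite_finset (seq_sub support)). Qed.

Lemma loop_subgraph : subgraph H G.
Proof. by exists (@ssval _ _); split=> //; exact: val_inj. Qed.

Let size_P a : size (P a) = n. Proof. by case: (uP a). Qed.

(** Out of range, [nth] returns the default [u], itself in the support; this makes [loop_point]
    total. *)
Let support_nth a k : nth u (u :: P a) k \in support.
Proof.
have [ks|ks] := ltnP k (size (u :: P a)); last by rewrite nth_default// mem_head.
have := mem_nth u ks; rewrite in_cons => /orP[/eqP->|kP]; first exact: mem_head.
rewrite in_cons; apply/orP; right; apply/flatten_mapP; exists a => //.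
by rewrite mem_enum.
Qed.

Let loop_point a k : H := SeqSub (support_nth a k).

(* The loop [P (w q)] is run through between the times [q * n] and [q * n + n]. *)
Let concat (w : int -> 'I_M.+1) : bisequence H :=
  fun i => loop_point (w (i %/ n)%Z) `|(i %% n)%Z|%N.

Let concatE w (q : int) (k : nat) : (k < n)%N ->
  concat w (q * n%:Z + k%:Z)%R = loop_point (w q) k.
Proof.
move=> kn; rewrite /concat divzMDl ?modzMDl; last by rewrite eqz_nat; lia.
by rewrite divz_small ?modz_small ?addr0//; lia.
Qed.

Let concat_two_sided w : two_sided_paths (concat w).
Proof.
move=> i; have n0 : (n%:Z != 0)%R by rewrite eqz_nat; lia.
have ik : (i = (i %/ n)%Z * n%:Z + `|(i %% n)%Z|%N%:Z)%R.
  by rewrite gez0_abs ?modz_ge0//; exact: divz_eq.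
have kn : (`|(i %% n)%Z| < n)%N.
  by have := ltz_pmod i (d := n%:Z); have := modz_ge0 i n0; lia.
move: kn ik; set q := (i %/ n)%Z; set k := `|(i %% n)%Z|%N => kn ->.
rewrite concatE// (_ : (_ + 1)%R = (q * n%:Z + k.+1%:Z)%R); last by lia.
have [ss us ls] := uP (w q).
have pk : arrow (nth u (u :: P (w q)) k) (nth u (P (w q)) k).
  by apply: (pathP u us); rewrite size_P.
have [kn'|kn'] := ltnP k.+1 n; first by rewrite concatE.
(* At the end of a block [k.+1 = n], and the next block starts at [u], the last vertex of every
   loop. *)
have -> : (q * n%:Z + k.+1%:Z = (q + 1) * n%:Z + 0%N%:Z)%R.
  by rewrite mulrDl mul1r addr0; congr (_ + _)%R; congr Posz; lia.
rewrite concatE//=; congr (is_true (arrow _ _)): pk.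
by rewrite -[RHS]ls -nth_last ss; congr nth; lia.
Qed.

Let zero_cover : set (set (bisequence H)) :=
  [set [set x | x 0%R = a] | a in [set: H]].

Lemma zero_cover_open (K : set (bisequence H)) : open_cover K zero_cover.
Proof.
split; last by move=> x _; exists [set y | y 0%R = x 0%R] => //; exists (x 0%R).
move=> _ [a _ <-]; rewrite openE => x /= <-; exact: coord_nbhs.
Qed.

(** Distinct words of [j] loops need distinct members of the subcover, because a member of the join
    fixes the vertex at every time below [j * n]. *)
Let min_subcover_ge j : (M.+1 ^ j)%:R%:E <=
  min_subcover R (@two_sided_paths H) (iter_join (@shift H) zero_cover (j * n)).
Proof.
apply: le_ereal_inf_tmp => _ [W [Wj KW] <-].
(* The blocks from [0] to [j - 1] spell [g]; [ord0] fills all the others. *)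
pose word (g : {ffun 'I_j -> 'I_M.+1}) (q : int) : 'I_M.+1 :=
  if q is Posz q' then (if insub q' is Some k then g k else ord0) else ord0.
have /choice[A AP] (g : {ffun 'I_j -> 'I_M.+1}) : exists A, W A /\ A (concat (word g)).
  by have [A WA Ag] := KW _ (concat_two_sided (word g)); exists A.
apply: (@le_trans _ _ (counting [set: {ffun 'I_j -> 'I_M.+1}])).
  rewrite -(counting_image (f := enum_rank)) => [|g g' _ _]; last exact: enum_rank_inj.
  rewrite (_ : _ @` _ = setT) ?counting_ord ?card_ffun ?card_ord//.
  by apply/seteqP; split=> // k _; exists (enum_val k) => //; rewrite enum_valK.
apply: (le_counting_inj (f := A)); last by move=> g _; exact: (AP g).1.
move=> g g' _ _ AA; apply/ffunP => q; apply: P_inj.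
have [a zA AE] := Wj _ (AP g).1.
have coord k : (k < n)%N -> loop_point (g q) k = loop_point (g' q) k.
  move=> kn; have qk : (q * n + k < j * n)%N by have := ltn_ord q; nia.
  have wE (h : {ffun 'I_j -> 'I_M.+1}) :
      loop_point (h q) k = concat (word h) (q * n + k)%N%:Z.
    by rewrite PoszD PoszM concatE//= /word valK.
  rewrite !wE.
  have {}zA := zA _ qk; case: zA => b _ bE.
  have ag h : A h = A g -> concat (word h) (q * n + k)%N%:Z = b.
    move=> hg; have := (AP h).2; rewrite hg -AE => /(_ _ qk); rewrite -bE => zb.
    have <- : iter (q * n + k) (@shift H) (concat (word h)) 0%R = b := zb.
    by rewrite iter_shift add0r.
  by rewrite !ag.
apply: (@eq_from_nth _ u) => [|k]; rewrite ?size_P// => kn.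
(* Entry [k] of a loop is point [k.+1] of its block; the final entry is [u] in both loops. *)
have [kn'|kn'] := ltnP k.+1 n.
  by have := congr1 (@ssval _ _) (coord k.+1 kn').
have kE : k = n.-1 by lia.
by rewrite kE -(size_P (g q)) nth_last size_P -(size_P (g' q)) nth_last;
  case: (uP (g q)) => _ _ ->; case: (uP (g' q)) => _ _ ->.
Qed.

Lemma loop_graph_entropy_ge :
  (n%:R^-1 * ln M.+1%:R)%:E <=
  topological_entropy R (@shift H) (@two_sided_paths H).
Proof.
apply: (@le_trans _ _ (cover_entropy R (@shift H) (@two_sided_paths H) zero_cover)).
  (* Along multiples of [n] the lower bound has the constant value claimed, which is enough for an
     upper limit. *)
  apply: le_limn_esup => j; exists (j.+1 * n)%N; first by nia.
  have -> : (n%:R^-1 * ln M.+1%:R =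
      (j.+1 * n)%:R^-1 * ln (M.+1 ^ j.+1)%:R :> R)%R.
    rewrite natrX lnXn// natrM -[(ln _ *+ _)%R]mulr_natl.
    by field; rewrite nat1r !pnatr_eq0 -lt0n n_gt0.
  rewrite EFinM lee_wpmul2l ?lee_fin ?invr_ge0//.
  rewrite -lne_EFin; last by rewrite ltr0n expn_gt0.
  rewrite lee_lne ?min_subcover_ge// in_itv /= ?leey ?min_subcover_ge0//.
  by rewrite andbT lee_fin.
by apply: ereal_sup_ubound; exists zero_cover => //; exact: zero_cover_open.
Qed.

End LoopSystem.

Section EntropyLowerBound.
Context {R : realType}.

Lemma lt_counting (T : choiceType) (A : set T) (x : R) : x%:E < counting A ->
  exists2 X : {fset T}, [set` X] `<=` A & (x < #|` X|%:R)%R.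
Proof.
have [fA|iA] := pselect (finite_set A) => xA.
  exists (fset_set A); first by rewrite fset_setK.
  by rewrite -lte_fin -counting_finite.
have [X XA nX] := infinite_set_fset (Num.truncn `|x|).+1 iA.
exists X => //; apply: le_lt_trans (ler_norm x) _.
have /andP[_ xn] := truncn_itv (normr_ge0 x).
by apply: lt_le_trans xn _; rewrite ler_nat.
Qed.

Lemma sums_le_geometric (s : R) : (0 <= s < 1)%R ->
  sums_le (fun k => s ^+ k)%R (1 - s)^-1%R.
Proof.
move=> /andP[s0 s1] N; rewrite -[leRHS]mul1r ler_pdivlMr ?subr_gt0//.
by rewrite mulrC -onem_expr gerBl exprn_ge0.
Qed.

(** Otherwise, closing paths from [u] to [v] by a fixed path of length [d] gives
    [p_ u v k <= r ^- (k + d)]; the series then converges at every [t < r], against the choice of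
    [u] and [v]. *)
Lemma graph_radius_lt_loops (G : graph) (r : R) : connected_graph G ->
  (0 < r)%R -> graph_radius R G < r%:E ->
  exists u : G, exists n, (r ^- n)%:E < p_ R u u n.
Proof.
move=> Gconn r0 /ereal_inf_lt[_ [[u v] _ <-]] /= uvr.
exists u; apply: contrapT => nu.
have pu n : p_ R u u n <= (r ^- n)%:E.
  by rewrite leNgt; apply/negP => nr; apply: nu; exists n.
have [d [s vu]] := Gconn v u.
have puv k : p_ R u v k <= (r ^- (k + d))%:E.
  have uu : paths u u 0 [::] by [].
  exact: le_trans (le_p_cat R k uu vu) (pu _).
move: uvr; rewrite ltNge => /negP; apply; apply: le_of_forall_lt => // t /andP[t0 tr].
apply: conv_radius_ge; first exact: ltW.
have tr0 : (0 <= t / r < 1)%R.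
  by rewrite divr_ge0 ?(ltW t0) ?(ltW r0)//= ltr_pdivrMr// mul1r.
have w0 k : (0 <= r ^- d * (t / r) ^+ k)%R.
  by rewrite mulr_ge0 ?exprn_ge0 ?invr_ge0 ?exprn_ge0 ?(ltW r0)//; case/andP: tr0.
apply: (@le_lt_trans _ _ (\sum_(0 <= k <oo) (r ^- d * (t / r) ^+ k)%:E)).
  apply: lee_nneseries => k _.
    by rewrite mule_ge0 ?p_ge0// lee_fin exprn_ge0// ltW.
  apply: (@le_trans _ _ ((r ^- (k + d))%:E * (t ^+ k)%:E)).
    by rewrite lee_wpmul2r ?puv// lee_fin exprn_ge0// ltW.
  rewrite -EFinM lee_fin expr_div_n exprD invfM.
  by rewrite le_eqVlt; apply/orP; left; apply/eqP; ring.
apply/(nneseries_lty_sums w0); exists (r ^- d * (1 - t / r)^-1)%R => N.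
rewrite -mulr_sumr ler_wpM2l ?invr_ge0 ?exprn_ge0 ?(ltW r0)//.
exact: sums_le_geometric.
Qed.

Lemma le_entropy (G : graph) (r : R) : connected_graph G -> (0 < r)%R ->
  graph_radius R G < r%:E -> (- ln r)%:E <= entropy R G.
Proof.
move=> Gconn r0 /(graph_radius_lt_loops Gconn r0)[u [n nr]].
have [X Xu Xr] := lt_counting nr.
(* At length 0 the strict inequality would read [1 < 1]. *)
have n0 : (0 < n)%N.
  rewrite lt0n; apply/eqP => n0; move: nr; rewrite n0 p_0 expr0 invr1.
  by rewrite ltxx.
have [M XM] : exists M, #|` X| = M.+1.
  case E : #|` X| => [|M]; last by exists M.
  by move: Xr; rewrite E ltNge invr_ge0 exprn_ge0 ?(ltW r0).
pose P (a : 'I_M.+1) : seq G := nth [::] X a.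
have PX a : P a \in X by rewrite mem_nth// XM.
have uP a : paths u u n (P a) by apply: Xu; exact: PX.
have P_inj : injective P.
  move=> a b /eqP; rewrite nth_uniq ?XM ?fset_uniq// => /eqP ab; exact: val_inj.
apply: (@le_trans _ _ (n%:R^-1 * ln M.+1%:R)%:E).
  rewrite lee_fin mulrC ler_pdivlMr ?ltr0n// mulNr mulrC mulr_natl -lnXn//.
  rewrite -lnV ?posrE ?exprn_gt0// ler_ln ?posrE ?invr_gt0 ?exprn_gt0//.
  by rewrite -XM ltW.
apply: le_trans (loop_graph_entropy_ge n0 P_inj uP) _.
apply: ereal_sup_ubound; exists (loop_graph u P); split => //.
- exact: loop_graph_finite.
- exact: loop_subgraph.
Qed.

End EntropyLowerBound.

(** * Entropy as minus the logarithm of the radius *)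

Section Gurevich.
Context {R : realType}.

(** A radius at least 1 would bound the entropy [h] by [h / 2]; a radius at most 0 would make it at
    least [h + 1]. *)
Lemma graph_radius_real (G : graph) : connected_graph G ->
  0 < entropy R G -> entropy R G < +oo ->
  exists rho : R, (0 < rho < 1)%R /\ graph_radius R G = rho%:E.
Proof.
move=> Gconn h0 hy; pose h := fine (entropy R G).
have hE : entropy R G = h%:E by rewrite fineK// ge0_fin_numE ?(ltW h0).
have {}h0 : (0 < h)%R by rewrite -lte_fin -hE.
have rG1 : graph_radius R G < 1.
  rewrite ltNge; apply/negP => rG.
  have : entropy R G <= (- ln (expR (- (h / 2))))%:E.
    apply: entropy_le; first exact: expR_gt0.
    by apply: lt_le_trans rG; rewrite lte_fin -[ltRHS]expR0 ltr_expR; lra.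
  by rewrite expRK hE lee_fin; lra.
have rG0 : 0 < graph_radius R G.
  rewrite ltNge; apply/negP => rG.
  have : (- ln (expR (- (h + 1))))%:E <= entropy R G.
    apply: le_entropy => //; first exact: expR_gt0.
    by apply: le_lt_trans rG _; rewrite lte_fin expR_gt0.
  by rewrite expRK hE lee_fin; lra.
have rE : graph_radius R G = (fine (graph_radius R G))%:E.
  by rewrite fineK// ge0_fin_numE ?(ltW rG0)// (lt_trans rG1)// ltry.
exists (fine (graph_radius R G)); split=> //.
by rewrite -!lte_fin -rE rG0.
Qed.

(** Both one-sided bounds ask for a number strictly on one side of the radius, hence the factors
    [expR (- e)] and [expR e]. *)
Lemma entropy_radius (G : graph) (rho : R) : connected_graph G ->
  (0 < rho)%R -> graph_radius R G = rho%:E -> entropy R G = (- ln rho)%:E.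
Proof.
move=> Gconn rho0 rhoE; apply/eqP; rewrite eq_le; apply/andP; split.
  apply/lee_addgt0Pr => e e0.
  have -> : (- ln rho)%:E + e%:E = (- ln (rho * expR (- e)))%:E.
    by rewrite lnM ?posrE ?expR_gt0// expRK opprD opprK EFinD.
  apply: entropy_le; first by rewrite mulr_gt0// expR_gt0.
  by rewrite rhoE lte_fin gtr_pMr// -expR0 ltr_expR oppr_lt0.
apply/lee_addgt0Pr => e e0; rewrite -leeBlDr//.
have -> : (- ln rho)%:E - e%:E = (- ln (rho * expR e))%:E.
  by rewrite lnM ?posrE ?expR_gt0// expRK opprD EFinB.
apply: le_entropy => //; first by rewrite mulr_gt0// expR_gt0.
by rewrite rhoE lte_fin ltr_pMr// -expR0 ltr_expR.
Qed.

End Gurevich.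

Theorem proposition2p8 (R : realType) (G : graph)
    (G_transient : transient R G)
    (entropy_gt0 : 0 < entropy R G) (entropy_lty : entropy R G < +oo) :
  [/\ exists G' : graph,
        [/\ subgraph G G', recurrent R G' & entropy R G' = entropy R G],
      (exists u : G, return_mean R u < +oo) ->
      exists G' : graph,
        [/\ subgraph G G', positive_recurrent R G' &
            entropy R G' = entropy R G]
    & ~ (exists u : G, return_mean R u < +oo) ->
      forall G' : graph,
        subgraph G G' -> recurrent R G' -> entropy R G' = entropy R G ->
        null_recurrent R G'].
Proof.
have [Gconn Gsum] := G_transient.
have [rho [rho01 rhoE]] := graph_radius_real Gconn entropy_gt0 entropy_lty.
have rho0 : (0 < rho)%R by case/andP: rho01.
have hE := entropy_radius Gconn rho0 rhoE.
have ext u := recurrent_extension Gconn rho01 rhoE (Gsum u).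
(* Without vertices the infimum defining the radius would be [+oo]. *)
have [u] : exists u : G, True.
  apply: contrapT => Gempty; have : graph_radius R G = +oo.
    rewrite /graph_radius (_ : [set _ | _ in _] = set0) ?ereal_inf0//.
    by apply/seteqP; split=> // x [[u _] _ _]; apply: Gempty; exists u.
  by rewrite rhoE.
move=> _; split.
- have [G' [GG' G'conn G'rho G'rec _]] := ext u.
  by exists G'; split=> //; rewrite hE (entropy_radius G'conn rho0 G'rho).
- move=> [{}u um]; have [G' [GG' G'conn G'rho _ G'pos]] := ext u.
  exists G'; split=> //; first exact: G'pos.
  by rewrite hE (entropy_radius G'conn rho0 G'rho).
- move=> mean_oo G' [i [i_inj i_arrow]] G'rec hG'.
  (* If [G'] were positive recurrent, equal entropies would give equal radii; as first-return counts
     grow with the graph, the mean at [u] in [G] would be finite. *)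
  case: (G'rec) => // -[G'conn /(_ (i u))[_]].
  have [rho' [/andP[rho'0 _] rho'E]] : exists rho' : R,
      (0 < rho' < 1)%R /\ graph_radius R G' = rho'%:E.
    by apply: graph_radius_real; rewrite ?hG'.
  have rr : rho' = rho.
    apply: ln_inj; rewrite ?posrE//; apply/eqP; rewrite -eqr_opp; apply/eqP.
    by apply: EFin_inj; rewrite -hE -hG' (entropy_radius G'conn rho'0 rho'E).
  rewrite rr in rho'E; move=> um; case: mean_oo; exists u; apply: le_lt_trans um.
  rewrite (return_meanE u (ltW rho0) rhoE) (return_meanE (i u) (ltW rho0) rho'E).
  have z0 k : (0 <= k.+1%:R * rho ^+ k.+1)%R by rewrite mulr_ge0// exprn_ge0// ltW.
  apply: lee_nneseries => k _; first by rewrite mule_ge0 ?f_ge0// lee_fin z0.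
  by rewrite lee_wpmul2r ?lee_fin ?z0//; exact: le_f_subgraph.
Qed.
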